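(* Let $0<a\le b\le2$, let $t\mapsto H_t\in[a,b]$ be a continuous function on $\mathbf{R}$, let $0<\alpha\le2$ and $\lambda>0$, and let $X_{H_t,\alpha,\lambda}(t)$ be the linear tempered multifractional stable motion. Assume that $H_t$ is $\gamma$-Hölder continuous with $\gamma>1/\alpha$, that is, there is a constant $C$ with $$|H_t-H_s|\le C|t-s|^\gamma$$ for all $t,s\in\mathbf{R}$ satisfying $|t-s|\le1$. If $\alpha\min\{a,\gamma\}>1$, then for any $0<\beta<\min\{a,\gamma\}-1/\alpha$, the process $X_{H_t,\alpha,\lambda}(t)$, $t\in\mathbf{R}$, has a continuous version whose paths are almost surely $\beta$-Hölder continuous on each compact set.
   Context: Conventions: $(x)_+=\max\{x,0\}$ and $0^\gamma=0$ for all $\gamma\in\mathbf{R}$. The linear tempered multifractional stable motion (LTmFSM) is $$X_{H_t,\alpha,\lambda}(t)=\int_{-\infty}^\infty G_{H_t,\alpha,\lambda}(t,x)\,dZ_\alpha(x),\quad G_{H_t,\alpha,\lambda}(t,x)=e^{-\lambda(t-x)_+}(t-x)_+^{H_t-\frac1\alpha}-e^{-\lambda(-x)_+}(-x)_+^{H_t-\frac1\alpha},$$ where $dZ_\alpha$ is an independently scattered symmetric $\alpha$-stable random measure on $\mathbf{R}$ with control measure $dx$, normalized so that $$\mathbf{E}\Big[e^{i\sum_{k=1}^n\theta_kX_{H_{t_k},\alpha,\lambda}(t_k)}\Big]=\exp\Big\{-\int_{-\infty}^\infty\Big|\sum_{k=1}^n\theta_kG_{H_{t_k},\alpha,\lambda}(t_k,x)\Big|^\alpha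 dx\Big\}.$$
   Formalization: For β > 1 (possible, e.g. α = 2, H ≡ 2, γ = 2), ''β-Hölder continuous'' is taken as k times differentiable with (β−k)-Hölder k-th derivative, k < β ≤ k+1, since the plain inequality would force constant paths; for β ≤ 1 it is the plain inequality on each compact set. *)

(* Defs.v *)
(* MathComp-Analysis, over an arbitrary realType. *)
From HB Require Import structures.
From mathcomp Require Export all_boot all_order all_algebra.
From mathcomp Require Export all_classical all_reals all_analysis.
From mathcomp Require Import complex.

Set Implicit Arguments.
Unset Strict Implicit.
Unset Printing Implicit Defensive.

Export Order.TTheory GRing.Theory Num.Theory.
Export numFieldNormedType.Exports.
Export HBSimple.

Local Open Scope classical_set_scope.
Local Open Scope ring_scope.

Section kernel.
Context {R : realType}.

(* The convention 0^g = 0 holds for every real exponent g, including g = 0,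
   where the library has 0 `^ 0 = 1. *)
Definition ppow (x g : R) : R := if x == 0 then 0 else x `^ g.

Definition pos_part (x : R) : R := Num.max x 0.

Definition ltmfsm_kernel (alpha lambda : R) (H : R -> R) (t x : R) : R :=
  expR (- lambda * pos_part (t - x))
    * ppow (pos_part (t - x)) (H t - alpha^-1)
  - expR (- lambda * pos_part (- x)) * ppow (pos_part (- x)) (H t - alpha^-1).

End kernel.

Section stable_random_measure.
Context {d : measure_display} {Omega : measurableType d} {R : realType}
  (P : probability Omega R).

Local Notation mu := (@lebesgue_measure R).

(* E[exp(i Y)] as an element of R[i]. *)
Definition expect_expi (Y : Omega -> R) : R[i] :=
  Complex (fine 'E_P[fun w => cos (Y w)]) (fine 'E_P[fun w => sin (Y w)]).

Definition finite_borel (A : set R) : Prop :=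
  measurable A /\ (mu A < +oo)%E.

(* The product rule for subfamilies follows by taking some B i = setT. *)
Definition mutually_independent (n : nat) (X : 'I_n -> {RV P >-> R}) : Prop :=
  forall B : 'I_n -> set R, (forall i, measurable (B i)) ->
    P (\bigcap_(i in [set: 'I_n]) (X i @^-1` B i))
    = (\prod_(i < n) P (X i @^-1` B i))%E.

(* Z is an independently scattered, sigma-additive symmetric alpha-stable
   random measure whose control measure is Lebesgue measure, up to the scale
   factor c.  Only the values of Z on Borel sets of finite Lebesgue measure are
   meaningful. *)
Definition stable_random_measure (alpha c : R) (Z : set R -> {RV P >-> R}) :
    Prop :=
  [/\ forall (n : nat) (A : 'I_n -> set R),
        (forall i, finite_borel (A i)) -> trivIset setT A ->
        mutually_independent (fun i => Z (A i)),
      forall A : (set R)^nat,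
        (forall j, finite_borel (A j)) -> trivIset setT A ->
        finite_borel (\bigcup_j A j) ->
        {ae P, forall w,
          series (fun j => Z (A j) w) @ \oo --> Z (\bigcup_j A j) w}
    & forall A : set R, finite_borel A -> forall theta : R,
        expect_expi (fun w => theta * Z A w)
        = (expR (- (c * fine (mu A) * `|theta| `^ alpha)))%:C%C].

(* The level set of f at 0, which has infinite measure, gets coefficient 0. *)
Definition simple_stable_integral (Z : set R -> {RV P >-> R})
    (f : {sfun measurableTypeR R >-> R}) (w : Omega) : R :=
  \sum_(x \in range f) x * Z (f @^-1` [set x]) w.

(* Y is the integral of f with respect to Z: the limit in probability of the
   integrals of simple functions converging to f in L^alpha. *)
Definition is_stable_integral (alpha : R) (Z : set R -> {RV P >-> R})
    (f : R -> R) (Y : Omega -> R) : Prop :=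
  [/\ measurable_fun setT (f : measurableTypeR R -> R),
      (\int[mu]_x (`|f x| `^ alpha)%:E < +oo)%E
    & exists s : nat -> {sfun measurableTypeR R >-> R},
      [/\ forall n x, x != 0 -> finite_borel (s n @^-1` [set x]),
          (\int[mu]_x (`|s n x - f x| `^ alpha)%:E)%E @[n --> \oo] --> 0%E
        & forall e : R, 0 < e ->
          P [set w | e <= `|simple_stable_integral Z (s n) w - Y w|]
            @[n --> \oo] --> 0%E]].

(* The last clause is the normalization that fixes the scale factor c of the
   random measure. *)
Definition is_LTmFSM (alpha lambda : R) (H : R -> R)
    (X : R -> {RV P >-> R}) : Prop :=
  exists (c : R) (Z : set R -> {RV P >-> R}),
    [/\ 0 < c,
        stable_random_measure alpha c Z,
        forall t : R,
          is_stable_integral alpha Z (ltmfsm_kernel alpha lambda H t) (X t)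
      & forall (n : nat) (theta t : 'I_n -> R),
          expect_expi (fun w => \sum_(k < n) theta k * X (t k) w)
          = (expR (- Rintegral mu setT (fun x =>
               `|\sum_(k < n) theta k * ltmfsm_kernel alpha lambda H (t k) x|
                 `^ alpha)))%:C%C].

Definition is_version (X Y : R -> {RV P >-> R}) : Prop :=
  forall t : R, {ae P, forall w, Y t w = X t w}.

End stable_random_measure.

Section holder.
Context {R : realType}.

Definition holder_on (beta : R) (K : set R) (f : R -> R) : Prop :=
  exists C : R, forall s t : R, K s -> K t ->
    `|f t - f s| <= C * `|t - s| `^ beta.

(* For 0 < beta <= 1 (so k = 0) this is holder_on beta K f for each compact K.
   For beta > 1 that inequality would only hold for functions constant on each
   interval, and beta-Hölder has its usual meaning C^{k, beta - k} with
   k < beta <= k + 1. *)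
Definition locally_holder (beta : R) (f : R -> R) : Prop :=
  exists k : nat,
    [/\ k%:R < beta <= k.+1%:R,
        forall j : nat, (j < k)%N -> forall x : R, derivable (derive1n j f) x 1
      & forall K : set R, compact K -> holder_on (beta - k%:R) K (derive1n k f)].

End holder.

(* Main.v *)
Require Import Defs.
From mathcomp Require Import ring lra zify measurable_realfun.

Set Implicit Arguments.
Unset Strict Implicit.
Unset Printing Implicit Defensive.

Local Open Scope classical_set_scope.
Local Open Scope ring_scope.

(* The characteristic function of a linear combination of the X t shows that its
   tail decays like u^-alpha, with a constant given by the L^alpha norm of the
   corresponding combination of kernels.  For every m < min(a, gamma) the second
   difference of the kernel at step h is O(h^m), up to translates of a fixed
   function of L^alpha; second differences are needed because the kernel may be
   smoother than C^1 (then gamma > 1 and H is constant).  A union bound over the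
   dyadic points of generation n shows that, almost surely, the dyadic second
   differences are O(2^(-n eta)) on every bounded interval, for each
   eta < m - 1/alpha.  Chaining along dyadic cells, applied to the path if
   eta < 1 and to its difference quotients if eta > 1, then gives a limit of
   class C^eta along dyadic approximations, and a Borel-Cantelli argument on
   first differences identifies it with X t for each t. *)

(** Near its singularity a kernel with exponent p = H_t - 1/alpha changes by about h^p at step h; a
    pointwise bound, followed by the union bound, would therefore reach only a - 2/alpha. The
    missing 1/alpha is recovered in L^alpha: differences are compared with h^m u^(-r), and r may
    approach 1/alpha while u^(-r) keeps an integrable alpha-th power near 0, so every m < a is
    available. The union over the 2^n cells of a generation then costs exactly 1/alpha, because
    against tails of order u^(-alpha) it raises the threshold by a factor 2^(n/alpha). First
    differences are never better than O(h) and would stop at order 1 - 1/alpha, a loss that is felt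
    already below order 1. The variation of the exponent H_t enters through |H_t - H_s| and limits m
    by gamma; no second-order smoothness of H has to be discussed, since m > 1 forces H to be
    constant. The order eta = 1 is avoided throughout: there the recursion that recovers first
    differences from second ones loses a logarithm. This is why eta is kept on the same side of 1 as
    beta. *)

Section kernel_envelope.
Context {R : realType}.
Implicit Types (lambda p r m mu h u v x y z : R).

(** * Powers, tempered powers and their integrable envelope *)

Lemma ler_powRl r x y : 0 <= r -> 0 <= x -> x <= y -> x `^ r <= y `^ r.
Proof.
move=> r0 x0 xy; apply: ge0_ler_powR => //; rewrite nnegrE //.
exact: le_trans xy.
Qed.

Lemma powR_D x r s : 0 < x -> x `^ (r + s) = x `^ r * x `^ s.
Proof. by move=> x0; rewrite powRD// (gt_eqF x0) implybT. Qed.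

Lemma powR_le_1D v x N : 0 < v -> 0 <= x -> x <= N -> v `^ x <= (1 + v) `^ N.
Proof.
move=> v0 x0 xN; apply: (@le_trans _ _ ((1 + v) `^ x)).
  by apply: ler_powRl => //; lra.
by apply: ler_powR => //; lra.
Qed.

(** The inequality 1 + y <= exp y at y = mu v / N, raised to the power N, beats the polynomial; the
    factor 1 + N / mu turns 1 + mu v / N into an upper bound for 1 + v. *)
Lemma powR_expR_bounded N mu : 0 < N -> 0 < mu ->
  exists2 C, 0 < C & forall v, 0 <= v -> (1 + v) `^ N <= C * expR (mu * v).
Proof.
move=> N0 mu0; have c0 : 0 < 1 + N / mu by rewrite addr_gt0// divr_gt0.
exists ((1 + N / mu) `^ N); first exact: powR_gt0.
move=> v v0; have -> : expR (mu * v) = expR (mu * v / N) `^ N.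
  by rewrite -expRM divfK// gt_eqF.
rewrite -powRM ?expR_ge0//; last exact: ltW.
apply: ler_powRl; [exact: ltW|lra|].
apply: (@le_trans _ _ ((1 + N / mu) * (1 + mu * v / N))); last first.
  by rewrite ler_pM2l// expR_ge1Dx.
have -> : (1 + N / mu) * (1 + mu * v / N) = 1 + v + N / mu + mu * v / N.
  by field; rewrite !gt_eqF.
rewrite -addrA lerDl addr_ge0// divr_ge0// ?mulr_ge0//; exact: ltW.
Qed.

Definition tempered_power lambda p u : R := expR (- lambda * u) * u `^ p.

Definition causal_kernel lambda p u : R :=
  expR (- lambda * pos_part u) * ppow (pos_part u) p.

(* Its alpha-th power is integrable as soon as r alpha < 1. *)
Definition envelope r mu u : R :=
  if 0 < u then u `^ (- r) * expR (- mu * u) else 0.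

Lemma ltmfsm_kernelE alpha lambda (H : R -> R) t x :
  ltmfsm_kernel alpha lambda H t x =
  causal_kernel lambda (H t - alpha^-1) (t - x)
    - causal_kernel lambda (H t - alpha^-1) (- x).
Proof. by []. Qed.

Lemma causal_kernel_pos lambda p u :
  0 < u -> causal_kernel lambda p u = tempered_power lambda p u.
Proof.
move=> u0; rewrite /causal_kernel /pos_part /ppow max_l; last exact: ltW.
by rewrite gt_eqF.
Qed.

Lemma causal_kernel_neg lambda p u : u <= 0 -> causal_kernel lambda p u = 0.
Proof.
by move=> u0; rewrite /causal_kernel /pos_part /ppow max_r// eqxx mulr0.
Qed.

Lemma envelope_ge0 r mu u : 0 <= envelope r mu u.
Proof.
by rewrite /envelope; case: ifP => // _; rewrite mulr_ge0// ?powR_ge0// expR_ge0.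
Qed.

Lemma causal_kernel_le lambda p u v : 0 < lambda -> 0 <= p -> 0 < v -> u <= v ->
  0 <= causal_kernel lambda p u <= v `^ p.
Proof.
move=> l0 p0 v0 uv; have [u0|u0] := leP u 0.
  by rewrite causal_kernel_neg// lexx powR_ge0.
rewrite causal_kernel_pos// /tempered_power mulr_ge0 ?expR_ge0 ?powR_ge0//=.
rewrite -[leRHS]mul1r ler_pM// ?expR_ge0 ?powR_ge0//.
  by rewrite -expR0 ler_expR mulNr oppr_le0 mulr_ge0// ltW.
by apply: ler_powRl => //; exact: ltW.
Qed.

Lemma is_derive_tempered_power lambda p u : 0 < u ->
  is_derive u 1 (tempered_power lambda p)
    (p * tempered_power lambda (p - 1) u - lambda * tempered_power lambda p u).
Proof.
move=> u0; have dl : is_derive u 1 (fun v => - lambda * v) (- lambda).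
  by apply: is_derive_eq; rewrite /GRing.scale/= mulr1.
have de := is_derive1_comp (is_derive_expR _) dl.
have dp := @is_derive1_powR _ p _ u0.
have dm := is_deriveM de dp.
apply: (@is_derive_eq _ _ _ _ _ _ _ _ dm).
by rewrite /tempered_power /= /GRing.scale /=; ring.
Qed.

Lemma tempered_power_ge0 lambda p u : 0 <= tempered_power lambda p u.
Proof. by rewrite mulr_ge0// ?expR_ge0// powR_ge0. Qed.

Lemma tempered_powerS lambda p u :
  0 < u -> tempered_power lambda (p + 1) u = u * tempered_power lambda p u.
Proof. by move=> u0; rewrite /tempered_power powR_D// powRr1 ?ltW//; ring. Qed.

Lemma mean_value_ineq (f df : R -> R) x y B : x < y ->
  (forall z, x <= z <= y -> is_derive z 1 f (df z)) ->
  (forall z, x < z < y -> `|df z| <= B) -> `|f y - f x| <= B * (y - x).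
Proof.
move=> xy fdf dfB.
have [z zxy||z zxy ->] := @MVT _ f df x y xy.
- by apply: fdf; move: zxy; rewrite in_itv/= => /andP[/ltW-> /ltW->].
- apply: derivable_within_continuous => z zxy.
  by have [] := fdf z; rewrite ?in_itv in zxy.
rewrite normrM (gtr0_norm (x := y - x)) ?subr_gt0// ler_pM2r ?subr_gt0//.
by apply: dfB; rewrite in_itv/= in zxy.
Qed.

(* Near the singularity of the kernel, where no cancellation is available. *)
Lemma powR_le_envelope r mu : 0 <= r -> 0 < mu -> exists2 C, 0 <= C &
  forall p m h v, p <= 2 -> m <= p + r -> 0 <= m -> m <= 2 ->
    0 < v -> v <= 4 * h -> h <= 1 ->
    v `^ p <= C * (h `^ m * envelope r mu v).
Proof.
(* Here 16 bounds 4^m, 5^(2 + r) bounds v^(p + r - m) because 1 + v <= 5, and exp(4 mu) offsets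
   exp(- mu v) because v <= 4. *)
move=> r0 mu0; exists (16 * 5 `^ (2 + r) * expR (4 * mu)).
  by rewrite !mulr_ge0// ?powR_ge0// expR_ge0.
move=> p m h v p2 mpr m0 m2 v0 v4h h1.
have h0 : 0 < h by nra.
rewrite /envelope v0.
have -> : v `^ p = v `^ m * v `^ (p + r - m) * 1 * v `^ (- r).
  by rewrite mulr1 -!powR_D//; congr (_ `^ _); ring.
have -> : 16 * 5 `^ (2 + r) * expR (4 * mu) *
    (h `^ m * (v `^ (- r) * expR (- mu * v))) =
  (16 * h `^ m) * 5 `^ (2 + r) * (expR (4 * mu) * expR (- mu * v)) * v `^ (- r).
  by ring.
rewrite ler_wpM2r ?powR_ge0// !ler_pM ?mulr_ge0 ?powR_ge0//.
- apply: (@le_trans _ _ ((4 * h) `^ m)); first by apply: ler_powRl => //; exact: ltW.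
  rewrite powRM//; last exact: ltW.
  rewrite ler_wpM2r ?powR_ge0//.
  have -> : (16 : R) = 4 `^ 2 by rewrite powR_mulrn//; ring.
  by apply: ler_powR => //; lra.
- apply: (@le_trans _ _ ((1 + v) `^ (2 + r))).
    by apply: powR_le_1D => //; lra.
  by apply: ler_powRl; lra.
- rewrite -expRD -[leLHS]expR0 ler_expR mulNr [4 * _]mulrC -mulrBr mulr_ge0//; lra.
Qed.

(** Away from the singularity h <= v, so the surplus h^(j - m) can be traded for v^(j - m); j is the
    order of the difference and xi a mean value point. The factor (1 + v)^2 leaves room for the
    powers of lambda u that come from differentiating the exponential. *)
Lemma tempered_power_le_envelope lambda r : 0 < lambda -> 0 <= r ->
  exists2 C, 0 <= C &
  forall p m j h xi v, p <= 2 -> 0 <= p -> m <= p + r -> 0 <= m -> m <= j -> j <= 2 ->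
    0 < h -> h <= v -> v / 2 <= xi -> xi <= v ->
    h `^ j * tempered_power lambda (p - j) xi * (1 + v) `^ 2
      <= C * (h `^ m * envelope r (lambda / 4) v).
Proof.
(* The exponent 4 + r is 2 + r, for v^(p + r - m), plus 2 for the slack (1 + v)^2. *)
move=> l0 r0; have [||K K0 HK] := @powR_expR_bounded (4 + r) (lambda / 4).
  by lra. by lra.
exists (4 * K); first by lra.
move=> p m j h xi v p2 p0 mpr m0 mj j2 h0 hv vxi xiv.
have v0 : 0 < v by lra.
have xi0 : 0 < xi by lra.
rewrite /envelope v0 /tempered_power.
have -> : h `^ j = h `^ m * h `^ (j - m) by rewrite -powR_D//; congr (_ `^ _); ring.
have E1 : h `^ (j - m) <= v `^ (j - m) by apply: ler_powRl => //; [lra|exact: ltW].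
(* Since xi >= v / 2, two factors exp(- lambda v / 4) are available: one goes into the envelope, the
   other absorbs the polynomial. *)
have E2 : expR (- lambda * xi) <= expR (- (lambda / 4) * v) * expR (- (lambda / 4) * v).
  by rewrite -expRD ler_expR; nra.
have E3 : xi `^ (p - j) <= v `^ (p - j) * 4.
  have -> : v `^ (p - j) * 4 = v `^ p * (v `^ (- j) * 4).
    by rewrite mulrA -powR_D.
  rewrite powR_D// ler_pM ?powR_ge0//; first by apply: ler_powRl => //; exact: ltW.
  rewrite !powRN -[4]invrK -invfM lef_pV2 ?posrE ?mulr_gt0 ?powR_gt0//.
  apply: (@le_trans _ _ ((v / 2) `^ j)); last by apply: ler_powRl; lra.
  rewrite powRM//; last exact: ltW.
  rewrite ler_pM2l ?powR_gt0//.
  have -> : 4^-1 = (2^-1 : R) `^ 2 by rewrite powR_mulrn//; field.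
  rewrite -!powR_inv1// -!powRrM ler_powR//; lra.
have E4 : v `^ (p + r - m) <= (1 + v) `^ (2 + r) by apply: powR_le_1D; lra.
have E5 := HK v (ltW v0).
have E6 : v `^ (j - m) * v `^ (p - j) = v `^ (- r) * v `^ (p + r - m).
  by rewrite -!powR_D//; congr (_ `^ _); ring.
have E7 : (1 + v) `^ (4 + r) = (1 + v) `^ (2 + r) * (1 + v) `^ 2.
  by rewrite -powR_D; [congr (_ `^ _); ring|lra].
have E8 : expR (- (lambda / 4) * v) * expR ((lambda / 4) * v) = 1.
  by rewrite -expRD mulNr addNr expR0.
apply: (@le_trans _ _ (h `^ m * v `^ (j - m) *
    ((expR (- (lambda / 4) * v) * expR (- (lambda / 4) * v)) * (v `^ (p - j) * 4)) *
    (1 + v) `^ 2)).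
  rewrite ler_wpM2r ?powR_ge0// !ler_pM ?mulr_ge0 ?powR_ge0 ?expR_ge0//.
have -> : h `^ m * v `^ (j - m) *
    ((expR (- (lambda / 4) * v) * expR (- (lambda / 4) * v)) * (v `^ (p - j) * 4)) *
    (1 + v) `^ 2 = 4 * (h `^ m * expR (- (lambda / 4) * v) * expR (- (lambda / 4) * v)
      * (v `^ (j - m) * v `^ (p - j)) * (1 + v) `^ 2) by ring.
rewrite E6.
have -> : 4 * (h `^ m * expR (- (lambda / 4) * v) * expR (- (lambda / 4) * v)
      * (v `^ (- r) * v `^ (p + r - m)) * (1 + v) `^ 2) =
  4 * (h `^ m * (v `^ (- r) * expR (- (lambda / 4) * v))) *
    (expR (- (lambda / 4) * v) * (v `^ (p + r - m) * (1 + v) `^ 2)) by ring.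
have -> : 4 * K * (h `^ m * (v `^ (- r) * expR (- (lambda / 4) * v))) =
  4 * (h `^ m * (v `^ (- r) * expR (- (lambda / 4) * v))) *
    (K * (expR (- (lambda / 4) * v) * expR ((lambda / 4) * v))) by rewrite E8; ring.
rewrite ler_wpM2l ?mulr_ge0 ?powR_ge0 ?expR_ge0//.
apply: (@le_trans _ _ (expR (- (lambda / 4) * v) * (1 + v) `^ (4 + r))).
  by rewrite ler_wpM2l ?expR_ge0// E7 ler_wpM2r ?powR_ge0.
have -> : K * (expR (- (lambda / 4) * v) * expR (lambda / 4 * v)) =
  expR (- (lambda / 4) * v) * (K * expR (lambda / 4 * v)) by ring.
by rewrite ler_wpM2l ?expR_ge0.
Qed.

End kernel_envelope.

(** * First differences of the causal kernel *)

Section kernel_first_difference.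
Context {R : realType}.
Implicit Types (lambda p r m mu h u v x y z : R).

Lemma envelope_neg r mu u : u <= 0 -> envelope r mu u = 0.
Proof. by rewrite /envelope ltNge => ->. Qed.

(** The constant is uniform over p in [p0, 2], so that it serves p = H_t - 1/alpha for all t at
    once. *)
Lemma causal_kernel_diff lambda p0 r m : 0 < lambda -> 0 <= p0 -> 0 <= r ->
  m <= p0 + r -> 0 <= m -> m <= 1 ->
  exists2 C, 0 <= C & forall p h v, p0 <= p -> p <= 2 -> 0 <= h -> h <= 1 ->
    `|causal_kernel lambda p v - causal_kernel lambda p (v - h)|
      <= C * (h `^ m * envelope r (lambda / 4) v).
Proof.
move=> l0 p00 r0 mpr m0 m1.
have [|C1 C10 H1] := @powR_le_envelope R r (lambda / 4) r0; first by lra.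
have [C2 C20 H2] := @tempered_power_le_envelope R lambda r l0 r0.
have A0 h v : 0 <= h `^ m * envelope r (lambda / 4) v.
  by rewrite mulr_ge0 ?powR_ge0 ?envelope_ge0.
exists (C1 + (2 + lambda) * C2); first by rewrite addr_ge0// mulr_ge0//; lra.
move=> p h v p0p p2; rewrite le_eqVlt => /predU1P[<- _|h0 h1].
  by rewrite subr0 subrr normr0 mulr_ge0// addr_ge0// mulr_ge0//; lra.
have [v0|v0] := leP v 0.
  by rewrite !causal_kernel_neg ?subrr ?normr0 ?envelope_neg ?mulr0//; lra.
(* Up to 4 h both values are bounded by v^p separately; beyond it the mean value point stays above v
   / 2. *)
have [v4|v4] := leP v (4 * h).
  apply: (@le_trans _ _ (C1 * (h `^ m * envelope r (lambda / 4) v))); last first.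
    by rewrite ler_wpM2r// lerDl mulr_ge0//; lra.
  apply: le_trans (H1 p m h v _ _ _ _ _ _ _); try lra.
  have /andP[a1 a2] : 0 <= causal_kernel lambda p v <= v `^ p by apply: causal_kernel_le; lra.
  have /andP[b1 b2] : 0 <= causal_kernel lambda p (v - h) <= v `^ p by apply: causal_kernel_le; lra.
  by rewrite ler_norml; apply/andP; split; lra.
apply: (@le_trans _ _ ((2 + lambda) * C2 * (h `^ m * envelope r (lambda / 4) v))); last first.
  by rewrite ler_wpM2r// lerDr.
rewrite !causal_kernel_pos; [|lra|lra].
have B1 : 0 <= ((2 + lambda) * C2 * (h `^ m * envelope r (lambda / 4) v)) / h.
  by apply: divr_ge0; [apply: mulr_ge0 => //; apply: mulr_ge0; lra|lra].
have -> : (2 + lambda) * C2 * (h `^ m * envelope r (lambda / 4) v) =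
  ((2 + lambda) * C2 * (h `^ m * envelope r (lambda / 4) v)) / h * (v - (v - h)).
  by field; rewrite gt_eqF.
apply: mean_value_ineq => [|z zv|z /andP[z1 z2] ]; first by lra.
  by apply: is_derive_tempered_power; lra.
rewrite ler_pdivlMr//.
have T := H2 p m 1 h z v _ _ _ _ _ _ _ _ _ _.
have {T}T : h `^ 1 * tempered_power lambda (p - 1) z * (1 + v) `^ 2 <=
    C2 * (h `^ m * envelope r (lambda / 4) v) by apply: T; lra.
apply: (@le_trans _ _ ((2 + lambda) * (h `^ 1 * tempered_power lambda (p - 1) z * (1 + v) `^ 2))); last first.
  by rewrite -[leRHS]mulrA ler_wpM2l//; lra.
have z0 : 0 < z by lra.
have -> : tempered_power lambda p z = z * tempered_power lambda (p - 1) z.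
  by rewrite -tempered_powerS// subrK.
rewrite powRr1; last exact: ltW.
rewrite powR_mulrn; last by lra.
set t := tempered_power _ _ _; have t0 : 0 <= t := tempered_power_ge0 _ _ _.
have -> : p * t - lambda * (z * t) = (p - lambda * z) * t by ring.
rewrite normrM (ger0_norm t0).
have -> : (2 + lambda) * (h * t * (1 + v) ^+ 2) = ((2 + lambda) * (1 + v) ^+ 2) * (t * h) by ring.
rewrite -(mulrA `|_|); apply: ler_wpM2r; first by rewrite mulr_ge0// ltW.
have zv : lambda * z <= lambda * v by rewrite ler_wpM2l; lra.
have zl : 0 <= lambda * z by rewrite mulr_ge0; lra.
have vl : 0 <= lambda * v by lra.
have vvl : 0 <= lambda * v * v by rewrite mulr_ge0//; lra.
have vv : 0 <= v * v by rewrite mulr_ge0; lra.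
have -> : (2 + lambda) * (1 + v) ^+ 2 =
  2 + lambda + 4 * v + 2 * (lambda * v) + 2 * (v * v) + lambda * v * v by ring.
rewrite ler_norml; apply/andP; split; lra.
Qed.

End kernel_first_difference.

(** * Second differences of the causal kernel *)

Section kernel_second_difference.
Context {R : realType}.
Implicit Types (lambda p r m mu h u v x y z : R).

(** Far from the singularity the mean value inequality is applied twice, to u |-> k(u) - k(u - h)
    and then to k'. The threshold 4 h is what keeps v - 2 h above v / 2. *)
Lemma causal_kernel_diff2 lambda p0 r m : 0 < lambda -> 0 <= p0 -> 0 <= r ->
  m <= p0 + r -> 0 <= m -> m <= 2 ->
  exists2 C, 0 <= C & forall p h v, p0 <= p -> p <= 2 -> 0 < h -> h <= 1 ->
    `|causal_kernel lambda p v - causal_kernel lambda p (v - h) *+ 2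
       + causal_kernel lambda p (v - h *+ 2)|
      <= C * (h `^ m * envelope r (lambda / 4) v).
Proof.
move=> l0 p00 r0 mpr m0 m2.
have [|C1 C10 H1] := @powR_le_envelope R r (lambda / 4) r0; first by lra.
have [C2 C20 H2] := @tempered_power_le_envelope R lambda r l0 r0.
have A0 h v : 0 <= h `^ m * envelope r (lambda / 4) v.
  by rewrite mulr_ge0 ?powR_ge0 ?envelope_ge0.
have L0 : 0 <= 2 + 4 * lambda + lambda * lambda by rewrite !addr_ge0// mulr_ge0; lra.
(* Near the singularity three values in [0, v^p] with weights 1, -2, 1 give 2 C1. The other factor
   collects |p (p - 1)| <= 2, 2 p lambda u <= 4 lambda (1 + v)^2 and (lambda u)^2 <= lambda^2 (1 +
   v)^2. *)
exists (2 * C1 + (2 + 4 * lambda + lambda * lambda) * C2).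
  by rewrite addr_ge0// mulr_ge0.
move=> p h v p0p p2 h0 h1.
have [v0|v0] := leP v 0.
  rewrite !causal_kernel_neg ?(envelope_neg _ _ v0) ?mulr0 ?mul0rn ?subrr ?addr0 ?normr0//; lra.
have [v4|v4] := leP v (4 * h).
  apply: (@le_trans _ _ (2 * C1 * (h `^ m * envelope r (lambda / 4) v))); last first.
    by rewrite ler_wpM2r// lerDl mulr_ge0.
  have H := H1 p m h v _ _ _ _ _ _ _.
  have {}H : v `^ p <= C1 * (h `^ m * envelope r (lambda / 4) v) by apply: H; lra.
  have /andP[a1 a2] : 0 <= causal_kernel lambda p v <= v `^ p by apply: causal_kernel_le; lra.
  have /andP[b1 b2] : 0 <= causal_kernel lambda p (v - h) <= v `^ p by apply: causal_kernel_le; lra.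
  have /andP[c1 c2] : 0 <= causal_kernel lambda p (v - h *+ 2) <= v `^ p by apply: causal_kernel_le; lra.
  by rewrite ler_norml; apply/andP; split; lra.
apply: (@le_trans _ _ ((2 + 4 * lambda + lambda * lambda) * C2 * (h `^ m * envelope r (lambda / 4) v))); last first.
  by rewrite ler_wpM2r// lerDr mulr_ge0.
rewrite !causal_kernel_pos; [|lra|lra|lra].
set Q := (2 + _ + _) * C2 * _.
have Q0 : 0 <= Q by rewrite mulr_ge0// mulr_ge0.
pose g u := tempered_power lambda p u - tempered_power lambda p (u - h).
pose dk q u := q * tempered_power lambda (q - 1) u - lambda * tempered_power lambda q u.
have -> : tempered_power lambda p v - tempered_power lambda p (v - h) *+ 2
    + tempered_power lambda p (v - h *+ 2) = g v - g (v - h).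
  rewrite /g; have -> : v - h - h = v - h *+ 2 by ring.
  ring.
have -> : Q = Q / h * (v - (v - h)) by field; rewrite gt_eqF.
apply: (@mean_value_ineq R g (fun u => dk p u - dk p (u - h))) => [|z zv|z /andP[z1 z2] ].
- by lra.
- have z0 : 0 < z - h by lra.
  have ds : is_derive z 1 (fun u => u - h) 1.
    by apply: is_derive_eq; rewrite subr0.
  have d1 : is_derive z 1 (tempered_power lambda p) (dk p z).
    by apply: is_derive_tempered_power; lra.
  have d2 := @is_derive1_comp R _ (fun u => u - h) _ _ _ (is_derive_tempered_power lambda p z0) ds.
  have dm := is_deriveB d1 d2.
  by apply: (@is_derive_eq _ _ _ _ _ _ _ _ dm); rewrite /dk mulr1.
have -> : Q / h = Q / (h * h) * (z - (z - h)).
  by field; rewrite gt_eqF.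
have ddk q u : 0 < u -> is_derive u 1 (tempered_power lambda q) (dk q u).
  exact: is_derive_tempered_power.
apply: (@mean_value_ineq R (dk p) (fun u => p * dk (p - 1) u - lambda * dk p u)) => [|u uz|u /andP[u1 u2] ].
- by lra.
- have u0 : 0 < u by lra.
  have dm := is_deriveB (is_deriveZ p (ddk (p - 1) u u0)) (is_deriveZ lambda (ddk p u u0)).
  by apply: (@is_derive_eq _ _ _ _ _ _ _ _ dm).
rewrite ler_pdivlMr ?mulr_gt0//.
have T := H2 p m 2 h u v _ _ _ _ _ _ _ _ _ _.
have {T}T : h `^ 2 * tempered_power lambda (p - 2) u * (1 + v) `^ 2 <=
    C2 * (h `^ m * envelope r (lambda / 4) v) by apply: T; lra.
apply: (@le_trans _ _ ((2 + 4 * lambda + lambda * lambda) *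
   (h `^ 2 * tempered_power lambda (p - 2) u * (1 + v) `^ 2))); last first.
  by rewrite /Q -[leRHS]mulrA ler_wpM2l.
have u0 : 0 < u by lra.
have E1 : tempered_power lambda (p - 1) u = u * tempered_power lambda (p - 2) u.
  by rewrite -tempered_powerS//; congr (tempered_power _ _ _); ring.
have E2 : tempered_power lambda p u = u * (u * tempered_power lambda (p - 2) u).
  by rewrite -E1 -tempered_powerS//; congr (tempered_power _ _ _); ring.
rewrite /dk E1 E2.
have -> : p - 1 - 1 = p - 2 by ring.
rewrite !powR_mulrn; [|lra|lra].
set t := tempered_power _ _ _; have t0 : 0 <= t := tempered_power_ge0 _ _ _.
have -> : p * ((p - 1) * t - lambda * (u * t)) - lambda * (p * (u * t) - lambda * (u * (u * t)))
  = (p * (p - 1) - 2 * (p * (lambda * u)) + (lambda * u) * (lambda * u)) * t by ring.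
rewrite normrM (ger0_norm t0).
have -> : (2 + 4 * lambda + lambda * lambda) * (h ^+ 2 * t * (1 + v) ^+ 2) =
  ((2 + 4 * lambda + lambda * lambda) * (1 + v) ^+ 2) * (t * (h * h)) by ring.
rewrite -!(mulrA `|_|); apply: ler_wpM2r; first by apply: mulr_ge0 => //; apply: mulr_ge0; exact: ltW.
have pp : p * (p - 1) <= 2 by nra.
have pp' : - 2 <= p * (p - 1) by nra.
have zl : 0 <= lambda * u by rewrite mulr_ge0; lra.
have zv : lambda * u <= lambda * (1 + v) by rewrite ler_wpM2l; lra.
have q1 : 0 <= p * (lambda * u) by rewrite mulr_ge0//; lra.
have q2 : p * (lambda * u) <= 2 * (lambda * (1 + v) ^+ 2).
  apply: ler_pM => //; first lra; apply: (le_trans zv).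
  by apply: ler_wpM2l; [exact: ltW|rewrite ler_eXnr//; lra].
have q3 : lambda * u * (lambda * u) <= lambda * lambda * (1 + v) ^+ 2.
  have -> : lambda * lambda * (1 + v) ^+ 2 = (lambda * (1 + v)) * (lambda * (1 + v)) by ring.
  exact: ler_pM.
have q4 : 0 <= lambda * u * (lambda * u) by rewrite mulr_ge0.
have q5 : 1 <= (1 + v) ^+ 2 by rewrite exprn_ege1//; lra.
set w := (1 + v) ^+ 2 in q2 q3 q5 *.
have -> : (2 + 4 * lambda + lambda * lambda) * w =
  2 * w + 4 * (lambda * w) + lambda * lambda * w by ring.
rewrite ler_norml; apply/andP; split; lra.
Qed.

End kernel_second_difference.

(** * Dependence of the causal kernel on its exponent *)

Section kernel_exponent.
Context {R : realType}.
Implicit Types (lambda p r m mu h u v x y z : R).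

(** With u^p the larger power, the ratio u^q / u^p is exp((q - p) ln u) and 1 - exp y <= - y.
    Keeping both powers on the right makes the bound symmetric in p and q. *)
Lemma powR_lipschitz_exponent p q u : 0 < u ->
  `|u `^ p - u `^ q| <= `|p - q| * `|ln u| * (u `^ p + u `^ q).
Proof.
move=> u0; wlog pq : p q / u `^ q <= u `^ p.
  move=> W; have [/W//|/ltW/W] := leP (u `^ q) (u `^ p).
  by rewrite distrC (distrC q) [_ `^ q + _]addrC.
rewrite ger0_norm ?subr_ge0//.
have -> : u `^ q = u `^ p * u `^ (q - p) by rewrite -powR_D//; congr (_ `^ _); ring.
have E : 1 - u `^ (q - p) <= `|p - q| * `|ln u|.
  rewrite {1}/powR gt_eqF// -normrM.
  have := expR_ge1Dx ((q - p) * ln u); have := ler_norm ((p - q) * ln u); lra.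
have N0 : 0 <= `|p - q| * `|ln u| by rewrite mulr_ge0.
have -> : u `^ p - u `^ p * u `^ (q - p) = (1 - u `^ (q - p)) * u `^ p by ring.
apply: (@le_trans _ _ (`|p - q| * `|ln u| * u `^ p)).
  by rewrite ler_wpM2r ?powR_ge0.
by rewrite ler_wpM2l// lerDl mulr_ge0 ?powR_ge0.
Qed.

(* Near 0 the logarithm is absorbed by the positive power [p0]. *)
Lemma causal_kernel_lipschitz_exponent lambda p0 r : 0 < lambda -> 0 < p0 -> 0 <= r ->
  exists2 C, 0 <= C & forall p q u, p0 <= p -> p <= 2 -> p0 <= q -> q <= 2 ->
    `|causal_kernel lambda p u - causal_kernel lambda q u|
      <= C * (`|p - q| * envelope r (lambda / 4) u).
Proof.
move=> l0 p00 r0.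
(* The exponent 3 + r: one for the logarithm, two for u^s with s <= 2, and r to undo u^(-r). *)
have [||K K0 HK] := @powR_expR_bounded R (3 + r) (lambda / 4); [lra|lra|].
exists (2 * (1 + p0^-1) * K); first by rewrite !mulr_ge0// ?addr_ge0// ?invr_ge0 ltW.
move=> p q u p0p p2 p0q q2.
have [u0|u0] := leP u 0.
  by rewrite !causal_kernel_neg// subrr normr0 envelope_neg// !mulr0.
rewrite !causal_kernel_pos// /tempered_power -mulrBr normrM ger0_norm ?expR_ge0//.
rewrite /envelope u0.
have L s : p0 <= s -> s <= 2 -> `|ln u| * u `^ s <= (1 + p0^-1) * (1 + u) `^ 3.
  move=> s1 s2; have pi0 : 0 < p0^-1 by rewrite invr_gt0.
  have [u1|u1] := leP u 1.
    rewrite ler0_norm ?ln_le0//.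
    have up : u `^ s <= u `^ p0.
      have -> : s = p0 + (s - p0) by ring.
      rewrite powR_D// ler_piMr ?powR_ge0//.
      have := @ler_powRl R (s - p0) u 1; rewrite powR1; apply => //; lra.
    apply: (@le_trans _ _ (- ln u * u `^ p0)).
      by rewrite ler_wpM2l// oppr_ge0 ln_le0.
    (* This is 1 + y <= exp y at y = - p0 ln u, where exp y = u^(- p0). *)
    have E : - (p0 * ln u) * u `^ p0 <= 1.
      have E1 : expR (- (p0 * ln u)) * u `^ p0 = 1.
        by rewrite /powR gt_eqF// -expRD addNr expR0.
      rewrite -E1 ler_wpM2r ?powR_ge0//.
      by have := expR_ge1Dx (- (p0 * ln u)); lra.
    apply: (@le_trans _ _ p0^-1).
      rewrite -[leRHS]mulr1 ler_pdivlMl//; apply: le_trans E; lra.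
    apply: (@le_trans _ _ ((1 + p0^-1) * 1)); first by lra.
    rewrite ler_pM2l ?addr_gt0//.
    by have := @ler_powRl R 3 1 (1 + u); rewrite powR1; apply; lra.
  rewrite ger0_norm; last by rewrite ln_ge0// ltW.
  have E1 : ln u <= (1 + u) `^ 1.
    rewrite powRr1; last by lra.
    have := @le_ln1Dx R (u - 1); have -> : 1 + (u - 1) = u by ring.
    by move=> H; rewrite (le_trans (H _))//; lra.
  have E2 : u `^ s <= (1 + u) `^ 2 by apply: powR_le_1D => //; lra.
  apply: (@le_trans _ _ ((1 + u) `^ 1 * (1 + u) `^ 2)).
    by rewrite ler_pM ?powR_ge0// ln_ge0// ltW.
  rewrite -powR_D; last by lra.
  have -> : 1 + 2 = 3 :> R by ring.
  by rewrite ler_peMl ?powR_ge0//; lra.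
have L1 := L p p0p p2; have L2 := L q p0q q2.
have E := powR_lipschitz_exponent p q u0.
have U : u `^ r <= (1 + u) `^ r by apply: powR_le_1D.
have E5 := HK u (ltW u0).
have Er : u `^ (- r) * u `^ r = 1 by rewrite -powR_D// addNr powRr0.
have E8 : expR (- lambda * u) * expR (lambda / 4 * u) <= expR (- (lambda / 4) * u).
  by rewrite -expRD ler_expR; nra.
apply: (@le_trans _ _ (expR (- lambda * u) * (`|p - q| * (2 * (1 + p0^-1) * (1 + u) `^ 3)))).
  rewrite ler_wpM2l ?expR_ge0//; apply: (le_trans E).
  by rewrite -[leLHS]mulrA ler_wpM2l//; lra.
have -> : expR (- lambda * u) * (`|p - q| * (2 * (1 + p0^-1) * (1 + u) `^ 3)) =
  2 * (1 + p0^-1) * (`|p - q| * (expR (- lambda * u) * (u `^ (- r) * u `^ r) * (1 + u) `^ 3)).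
  by rewrite Er; ring.
rewrite -[2 * (1 + p0^-1) * K * _]mulrA; apply: ler_wpM2l.
  by rewrite mulr_ge0// addr_ge0// invr_ge0 ltW.
rewrite (mulrCA K) ler_wpM2l//.
  apply: (@le_trans _ _ (u `^ (- r) * (expR (- lambda * u) * ((1 + u) `^ (3 + r))))).
    rewrite (powR_D 3 r); last by lra.
    have -> : expR (- lambda * u) * (u `^ (- r) * u `^ r) * (1 + u) `^ 3 =
      u `^ (- r) * (expR (- lambda * u) * ((1 + u) `^ 3 * u `^ r)) by ring.
    by rewrite !ler_wpM2l ?powR_ge0 ?expR_ge0.
  have -> : K * (u `^ (- r) * expR (- (lambda / 4) * u)) =
     u `^ (- r) * (K * expR (- (lambda / 4) * u)) by ring.
  rewrite ler_wpM2l ?powR_ge0//.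
  apply: (@le_trans _ _ (K * (expR (- lambda * u) * expR (lambda / 4 * u)))).
    by rewrite mulrCA ler_wpM2l ?expR_ge0.
  by rewrite ler_wpM2l// ltW.
Qed.

End kernel_exponent.

(** * Integrability of the alpha-th power of the envelope *)

Section envelope_integral.
Context {R : realType}.
Local Notation mu := (@lebesgue_measure R).

Lemma measurable_envelope (r nu c : R) :
  measurable_fun [set: measurableTypeR R] (fun x : measurableTypeR R => envelope r nu (c - x)).
Proof.
have mc : measurable_fun [set: measurableTypeR R] (fun x : measurableTypeR R => c - x).
  exact: measurable_funB.
apply: measurable_fun_ifT => //.
- exact: measurable_fun_ltr.
- apply: measurable_funM.
    exact: measurableT_comp (measurable_powR _) mc.
  apply: measurableT_comp => //.
  exact: measurable_funM.
Qed.

(** With v = c - x this is v / (1 + v). The substitution maps v > 0 onto ]0, 1[, so that a single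
    antiderivative handles both the singularity at v = 0 and the tail at infinity. *)
Definition log_ratio (c x : R) : R := 1 - (1 + (c - x))^-1.

Lemma log_ratio_itv c x : x < c -> 0 < log_ratio c x < 1.
Proof.
move=> xc; have v0 : 0 < c - x by rewrite subr_gt0.
have q1 : (1 + (c - x))^-1 < 1 by rewrite invf_lt1; lra.
have q0 : 0 < (1 + (c - x))^-1 by rewrite invr_gt0; lra.
by rewrite /log_ratio; apply/andP; split; lra.
Qed.

Lemma is_derive_inv1D (c x : R) : x < c ->
  is_derive x 1 (fun u : R => (1 + (c - u))^-1) ((1 + (c - x)) ^- 2).
Proof.
move=> xc.
have dl : is_derive x 1 (fun u : R => 1 + (c - u)) (- 1).
  have d1 := is_deriveD (is_derive_cst (1 : R) x 1)
    (is_deriveB (is_derive_cst (c : R) x 1) (is_derive_id x 1)).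
  by apply: (@is_derive_eq _ _ _ _ _ _ _ _ d1); rewrite sub0r add0r.
have n0 : (fun u : R => 1 + (c - u)) x != 0 by rewrite gt_eqF//; lra.
have d2 := @is_deriveV R (fun u => 1 + (c - u)) x (- 1) 1 n0 dl.
apply: (@is_derive_eq _ _ _ _ _ _ _ _ d2).
by rewrite /GRing.scale/= mulrN1 opprK.
Qed.

Lemma is_derive_log_ratio_powR (c x q : R) : x < c ->
  is_derive x 1 (fun u => log_ratio c u `^ q)
    (- (q * (log_ratio c x `^ (q - 1) * (1 + (c - x)) ^- 2))).
Proof.
move=> xc; have /andP[w0 _] := log_ratio_itv xc.
have dw : is_derive x 1 (log_ratio c) (- (1 + (c - x)) ^- 2).
  have d1 := is_deriveB (is_derive_cst (1:R) x 1) (is_derive_inv1D xc).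
  by apply: (@is_derive_eq _ _ _ _ _ _ _ _ d1); rewrite sub0r.
have dm := is_derive1_comp (@is_derive1_powR R q _ w0) dw.
by apply: (@is_derive_eq _ _ _ _ _ _ _ _ dm); rewrite mulrN mulrA.
Qed.

Lemma continuous_log_ratio_density (c s x y : R) : y < c ->
  {within `[x, y], continuous
    (fun u => log_ratio c u `^ (s - 1) * (1 + (c - u)) ^- 2)}.
Proof.
move=> yc; apply: derivable_within_continuous => u; rewrite in_itv/= => /andP[_ uy].
have uc : u < c by lra.
have d1 := is_derive_log_ratio_powR (s - 1) uc.
have d2 := is_derive_inv1D uc.
have dm := is_deriveM d1 (is_deriveM d2 d2).
have -> : (fun u0 : R => log_ratio c u0 `^ (s - 1) / (1 + (c - u0)) ^+ 2) =
  (fun u => log_ratio c u `^ (s - 1)) * ((fun u0 => (1 + (c - u0))^-1) * (fun u0 => (1 + (c - u0))^-1)).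
  by apply/funext => z /=; rewrite /GRing.mul/= expr2 invfM.
by case: dm.
Qed.

(** Writing w for [log_ratio c], an antiderivative is - w^s / s; as 0 < w < 1, the bound depends
    neither on the interval nor on c. *)
Lemma integral_log_ratio (c s x y : R) : 0 < s -> x < y -> y < c ->
  (\int[mu]_(u in `[x, y]) (log_ratio c u `^ (s - 1) * (1 + (c - u)) ^- 2)%:E
    <= (s^-1)%:E)%E.
Proof.
move=> s0 xy yc.
pose F (u : R) := - (s^-1 * log_ratio c u `^ s).
have dF u : u < c -> is_derive u 1 F (log_ratio c u `^ (s - 1) * (1 + (c - u)) ^- 2).
  move=> uc; have d1 := is_deriveN (is_deriveZ s^-1 (is_derive_log_ratio_powR s uc)).
  apply: (@is_derive_eq _ _ _ _ _ _ _ _ d1).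
  by rewrite /GRing.scale/= mulrN opprK mulKf// gt_eqF.
have cF u : u < c -> {for u, continuous F}.
  by move=> uc; have [d _] := dF u uc; apply: differentiable_continuous; apply/derivable1_diffP.
rewrite (@continuous_FTC2 _ _ F)//; last first.
- by move=> u; rewrite in_itv/= => /andP[_ uy]; have [|_ <-] := dF u; [lra|exact: derive1E].
- split.
  + move=> u; rewrite in_itv/= => /andP[_ uy].
    by have [|//] := dF u; lra.
  + by apply: cvg_at_right_filter; apply: cF; lra.
  + by apply: cvg_at_left_filter; apply: cF.
- exact: continuous_log_ratio_density.
rewrite -EFinB lee_fin /F.
have /andP[a0 a1] : 0 < log_ratio c x < 1 by apply: log_ratio_itv; lra.
have a2 : s^-1 * log_ratio c x `^ s <= s^-1 * 1.
  rewrite ler_wpM2l ?invr_ge0 ?(ltW s0)//.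
  by have := @ler_powRl R s (log_ratio c x) 1; rewrite powR1; apply; lra.
have a3 : 0 <= s^-1 * log_ratio c y `^ s by rewrite mulr_ge0 ?powR_ge0 ?invr_ge0 ?(ltW s0).
lra.
Qed.

(** From w <= v follows v^(- r alpha) <= w^(- r alpha), and the exponential is dominated by (1 +
    v)^(-2), the Jacobian of the substitution. *)
Lemma envelope_powR_le alpha r nu : 0 < alpha -> 0 <= r -> 0 < nu ->
  exists2 K, 0 < K & forall c u, u < c ->
    envelope r nu (c - u) `^ alpha
      <= K * (log_ratio c u `^ ((1 - r * alpha) - 1) * (1 + (c - u)) ^- 2).
Proof.
move=> a0 r0 nu0; have [||K K0 HK] := @powR_expR_bounded R 2 (nu * alpha).
  by []. by rewrite mulr_gt0.
exists K => // c u uc; have v0 : 0 < c - u by rewrite subr_gt0.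
have /andP[w0 w1] := log_ratio_itv uc.
rewrite /envelope v0 powRM ?powR_ge0 ?expR_ge0// -powRrM -expRM.
have {}HK := HK (c - u) (ltW v0).
rewrite powR_mulrn in HK; last by lra.
have -> : K * (log_ratio c u `^ ((1 - r * alpha) - 1) * (1 + (c - u)) ^- 2) =
  log_ratio c u `^ (- r * alpha) * (K * (1 + (c - u)) ^- 2).
  by rewrite mulrCA; congr (_ `^ _ * _); ring.
rewrite ler_pM ?powR_ge0 ?expR_ge0//.
  rewrite !mulNr !powRN lef_pV2 ?posrE ?powR_gt0// ler_powRl//.
  - by rewrite mulr_ge0// ltW.
  - by rewrite ltW.
  rewrite /log_ratio lerBlDr -lerBlDl.
  have q0 : 0 < 1 + (c - u) by lra.
  have q1 : (1 + (c - u)) * (1 + (c - u))^-1 = 1 by rewrite divff// gt_eqF.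
  have q2 : 0 < (1 + (c - u))^-1 by rewrite invr_gt0.
  nra.
rewrite ler_pdivlMr ?exprn_gt0//; last by lra.
have E : expR (- nu * (c - u) * alpha) * expR (nu * alpha * (c - u)) = 1.
  by rewrite -expRD -[RHS]expR0; congr expR; ring.
apply: (@le_trans _ _ (expR (- nu * (c - u) * alpha) * (K * expR (nu * alpha * (c - u))))).
  by rewrite ler_wpM2l ?expR_ge0.
by rewrite mulrCA E mulr1.
Qed.

Lemma integral_envelope_bounded alpha r nu : 0 < alpha -> 0 <= r -> 0 < nu ->
  r * alpha < 1 -> exists2 B, 0 <= B &
  forall c, (\int[mu]_x (envelope r nu (c - x) `^ alpha)%:E <= B%:E)%E.
Proof.
move=> a0 r0 nu0 ra; have [K K0 HK] := envelope_powR_le a0 r0 nu0.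
have s0 : 0 < 1 - r * alpha by rewrite subr_gt0.
exists (K * (1 - r * alpha)^-1); first by rewrite mulr_ge0// ?invr_ge0 ltW.
move=> c.
(* Compact intervals increasing to ]-oo, c[; the shift by 2 makes the first one nondegenerate. *)
pose A (n : nat) : set R := [set` `[c - n%:R - 2, c - n.+1%:R^-1]].
have mJ D : measurable_fun D (fun x : measurableTypeR R => (envelope r nu (c - x) `^ alpha)%:E).
  apply/measurable_EFinP; apply: (measurable_funS measurableT) => //.
  exact: measurableT_comp (measurable_powR _) (measurable_envelope _ _ _).
have J0 x : (0 <= (envelope r nu (c - x) `^ alpha)%:E)%E by rewrite lee_fin powR_ge0.
have -> : (\int[mu]_x (envelope r nu (c - x) `^ alpha)%:E =
  \int[mu]_(x in \bigcup_n A n) (envelope r nu (c - x) `^ alpha)%:E)%E.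
  rewrite [RHS]integral_mkcond; apply: eq_integral => x _; rewrite patchE.
  case: ifPn => // /negP xA; rewrite envelope_neg ?powR0 ?gt_eqF//.
  rewrite leNgt subr_gt0; apply/negP => xc; apply: xA; rewrite inE.
  have [k k1] : exists k : nat, (c - x)^-1 <= k%:R /\ c - x <= k%:R.
    exists (maxn (Num.bound (c - x)^-1) (Num.bound (c - x))).
    have v0 : 0 <= c - x by rewrite ltW// subr_gt0.
    have vi0 : 0 <= (c - x)^-1 by rewrite invr_ge0.
    split; [apply: (le_trans (ltW (archi_boundP vi0)))|apply: (le_trans (ltW (archi_boundP v0)))].
      by rewrite ler_nat leq_maxl.
    by rewrite ler_nat leq_maxr.
  exists k => //; rewrite /A/= in_itv/=; case: k1 => k1 k2.
  apply/andP; split; first by lra.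
  rewrite lerBrDr -lerBrDl; rewrite invf_ple ?posrE ?subr_gt0//.
  by rewrite (le_trans k1)// ler_nat.
have h := @ge0_nondecreasing_set_cvg_integral _ (measurableTypeR R) R A
  (fun x : measurableTypeR R => (envelope r nu (c - x) `^ alpha)%:E) mu.
have {}h := h _ (fun=> measurable_itv _) (fun=> mJ _) (fun _ x _ => J0 x).
have homoA : {homo A : n m / (n <= m)%N >-> (n <= m)%O}.
  move=> n m nm; apply/subsetPset; apply: subset_itv; rewrite bnd_simp.
    by rewrite lerB// lerB// ler_nat.
  by rewrite lerB// lef_pV2 ?posrE// ler_nat.
have /cvg_lim<- // := h homoA.
apply: lime_le.
  apply: ereal_nondecreasing_is_cvgn => n m nm.
  apply: ge0_subset_integral => //; try exact: measurable_itv.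
  exact/subsetPset/homoA.
apply: nearW => n.
have i1 : n.+1%:R^-1 <= 1 :> R by rewrite invf_le1// ler1n.
have i0 : 0 < n.+1%:R^-1 :> R by rewrite invr_gt0.
have n0 : 0 <= n%:R :> R by [].
have yc : c - n.+1%:R^-1 < c by rewrite ltrBlDr ltrDl.
have xy : c - n%:R - 2 < c - n.+1%:R^-1.
  by move: i1 i0; move: (n.+1%:R^-1) => i i1 i0; lra.
pose g (u : measurableTypeR R) := (log_ratio c u `^ ((1 - r * alpha) - 1) * (1 + (c - u)) ^- 2)%:E.
have mg : measurable_fun (A n) g.
  apply/measurable_EFinP; apply: subspace_continuous_measurable_fun.
    exact: measurable_itv.
  apply: continuous_log_ratio_density.
  exact: yc.
apply: (@le_trans _ _ (\int[mu]_(x in A n) (K%:E * g x))%E).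
  apply: ge0_le_integral => //; first exact: measurable_itv.
    exact: measurable_funeM.
  move=> x; rewrite /A/= in_itv/= => /andP[_ xc].
  by rewrite -EFinM lee_fin; apply: HK; exact: le_lt_trans yc.
rewrite ge0_integralZl//; last 3 first.
- exact: measurable_itv.
- by move=> x _; rewrite lee_fin mulr_ge0 ?powR_ge0// invr_ge0 sqr_ge0.
- by rewrite lee_fin ltW.
rewrite EFinM lee_wpmul2l ?lee_fin ?(ltW K0)//.
exact: integral_log_ratio.
Qed.

End envelope_integral.

(** * Increments of the LTmFSM kernel *)

Section ltmfsm_increments.
Context {R : realType}.
Local Notation mu := (@lebesgue_measure R).

(** Each y i is at most M, the power 1/alpha of the sum of the y i^alpha. The argument treats alpha
    < 1 and alpha >= 1 alike, without convexity. *)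
Lemma powR_sum_le (I : Type) (s : seq I) (y : I -> R) (alpha : R) :
  0 < alpha -> (forall i, 0 <= y i) ->
  (\sum_(i <- s) y i) `^ alpha <= (size s)%:R `^ alpha * \sum_(i <- s) y i `^ alpha.
Proof.
move=> a0 y0; set S := \sum_(i <- s) y i `^ alpha.
have S0 : 0 <= S by apply: sumr_ge0 => i _; exact: powR_ge0.
pose M := S `^ alpha^-1.
have sM : \sum_(i <- s) y i <= (size s)%:R * M.
  have : forall s' : seq I, \sum_(j <- s') y j `^ alpha <= S ->
      \sum_(i <- s') y i <= (size s')%:R * M.
    elim=> [|i s' IH] hi; first by rewrite big_nil mul0r.
    rewrite big_cons in hi.
    have t0 : 0 <= \sum_(j <- s') y j `^ alpha.
      by apply: sumr_ge0 => j _; exact: powR_ge0.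
    have yi0 := powR_ge0 (y i) alpha.
    rewrite big_cons /= -natr1 mulrDl mul1r addrC lerD//.
      by apply: IH; lra.
    have -> : y i = (y i `^ alpha) `^ alpha^-1.
      by rewrite -powRrM divff ?gt_eqF// powRr1.
    by apply: ler_powRl; rewrite ?invr_ge0 ?(ltW a0)//; lra.
  by apply.
apply: (@le_trans _ _ (((size s)%:R * M) `^ alpha)).
  by apply: ler_powRl; rewrite ?(ltW a0)//; apply: sumr_ge0.
by rewrite powRM ?powR_ge0// -powRrM mulVf ?gt_eqF// powRr1.
Qed.

(** Cutting [s, s + h] into n equal pieces bounds the increment by C h^gamma n^(1 - gamma), which
    tends to 0. *)
Lemma holder_gt1_cst (H : R -> R) (C gamma : R) : 1 < gamma ->
  (forall t s, `|t - s| <= 1 -> `|H t - H s| <= C * `|t - s| `^ gamma) ->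
  forall t s, H t = H s.
Proof.
move=> g1 HC.
suff W s (h : R) : 0 <= h -> H (s + h) = H s.
  move=> t s; have [st|ts] := leP s t.
    by rewrite -(W s (t - s)) ?subr_ge0// addrC subrK.
  by rewrite -(W t (s - t)) ?subr_ge0 1?ltW// addrC subrK.
move=> h0; apply/eqP; rewrite -subr_eq0 -normr_eq0 -[_ == 0]negbK.
apply/negP => n0; have d0 : 0 < `|H (s + h) - H s| by rewrite lt0r n0 normr_ge0.
have C0 : 0 <= C.
  have := HC (s + 1) s; have -> : s + 1 - s = 1 by ring.
  by rewrite normr1 powR1 mulr1 => /(_ (lexx _)); apply: le_trans.
have B (n : nat) : h <= n.+1%:R ->
    `|H (s + h) - H s| <= C * h `^ gamma * n.+1%:R `^ (1 - gamma).
  move=> hn; have k0 : 0 < n.+1%:R :> R by [].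
  pose e := h / n.+1%:R.
  have e0 : 0 <= e by rewrite divr_ge0.
  have e1 : e <= 1 by rewrite ler_pdivrMr// mul1r.
  have T k : `|H (s + e *+ k) - H s| <= (C * e `^ gamma) *+ k.
    elim: k => [|k IH]; first by rewrite !mulr0n addr0 subrr normr0.
    have -> : H (s + e *+ k.+1) - H s =
      (H (s + e *+ k.+1) - H (s + e *+ k)) + (H (s + e *+ k) - H s) by ring.
    apply: le_trans (ler_normD _ _) _; rewrite [leRHS]mulrS lerD//.
    have := HC (s + e *+ k.+1) (s + e *+ k).
    have -> : s + e *+ k.+1 - (s + e *+ k) = e by rewrite mulrS; ring.
    by rewrite (ger0_norm e0); exact.
  have := T n.+1.
  have -> : e *+ n.+1 = h by rewrite -mulr_natr /e divfK// gt_eqF.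
  move/le_trans; apply; rewrite -mulr_natr /e powRM ?invr_ge0//.
  rewrite powR_D// powRr1// powRN -powR_inv1// -powRrM mulN1r powRN.
  by rewrite le_eqVlt; apply/orP; left; apply/eqP; ring.
have K0 : 0 < 1 + C * h `^ gamma by have := powR_ge0 h gamma; nra.
pose d := `|H (s + h) - H s|.
(* The summand h makes the pieces no longer than 1; the other one pushes the bound below the
   supposed increment d. *)
pose N := Num.bound (h + ((1 + C * h `^ gamma) / d) `^ (gamma - 1)^-1).
have Q0 : 0 <= ((1 + C * h `^ gamma) / d) `^ (gamma - 1)^-1 by exact: powR_ge0.
have Nb : h + ((1 + C * h `^ gamma) / d) `^ (gamma - 1)^-1 < N%:R.
  by apply: archi_boundP; rewrite addr_ge0.
have NS : N%:R <= N.+1%:R :> R by rewrite ler_nat.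
have hN : h <= N.+1%:R by lra.
have := B N hN; rewrite leNgt => /negP; apply.
have p0 : 0 < N.+1%:R `^ (gamma - 1) :> R by rewrite powR_gt0.
have -> : 1 - gamma = - (gamma - 1) by ring.
rewrite powRN ltr_pdivrMr//.
have E : (1 + C * h `^ gamma) / d <= N.+1%:R `^ (gamma - 1).
  have -> : (1 + C * h `^ gamma) / d =
    (((1 + C * h `^ gamma) / d) `^ (gamma - 1)^-1) `^ (gamma - 1).
    rewrite -powRrM mulVf; last by rewrite gt_eqF// subr_gt0.
    by rewrite powRr1// divr_ge0 ?ltW.
  by apply: ler_powRl => //; lra.
rewrite ler_pdivrMr// in E; rewrite -/d [d * _]mulrC; lra.
Qed.

Lemma measurable_envelope_powR (r nu c alpha : R) :
  measurable_fun [set: measurableTypeR R]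
    (fun x : measurableTypeR R => (envelope r nu (c - x) `^ alpha)%:E).
Proof.
apply/measurable_EFinP.
exact: measurableT_comp (measurable_powR _) (measurable_envelope _ _ _).
Qed.

(** Only the number of translates is fixed, not their centres: this makes the tail bounds uniform in
    t and h. *)
Lemma Rintegral_envelopes (alpha r nu : R) (N : nat) : 0 < alpha -> 0 <= r -> 0 < nu ->
  r * alpha < 1 -> exists2 B, 0 <= B &
  forall (f : R -> R) (D : R) (cs : seq R),
    measurable_fun setT (f : measurableTypeR R -> R) -> 0 <= D -> (size cs <= N)%N ->
    (forall x, `|f x| <= D * \sum_(c <- cs) envelope r nu (c - x)) ->
    Rintegral mu setT (fun x => `|f x| `^ alpha) <= B * D `^ alpha.
Proof.
move=> a0 r0 nu0 ra; have [B B0 HB] := integral_envelope_bounded a0 r0 nu0 ra.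
exists (N%:R `^ alpha * (N%:R * B)).
  by rewrite !mulr_ge0 ?powR_ge0.
move=> f D cs mf D0 sN fD.
pose K := D `^ alpha * N%:R `^ alpha.
have K0 : 0 <= K by rewrite mulr_ge0 ?powR_ge0.
have I : (\int[mu]_x (`|f x| `^ alpha)%:E <=
    (N%:R `^ alpha * (N%:R * B) * D `^ alpha)%:E)%E.
  apply: (@le_trans _ _ (\int[mu]_x (K%:E * \sum_(c <- cs) (envelope r nu (c - x) `^ alpha)%:E))%E).
    apply: ge0_le_integral => //.
    - apply/measurable_EFinP; apply: measurableT_comp (measurable_powR _) _.
      exact: measurableT_comp.
    - apply: measurable_funeM; apply: emeasurable_sum => c.
      exact: measurable_envelope_powR.
    - move=> x _; rewrite sumEFin -EFinM lee_fin.
      have E0 : 0 <= \sum_(c <- cs) envelope r nu (c - x).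
        by apply: sumr_ge0 => c _; exact: envelope_ge0.
      apply: (@le_trans _ _ ((D * \sum_(c <- cs) envelope r nu (c - x)) `^ alpha)).
        by apply: ler_powRl => //; exact: ltW.
      rewrite powRM// /K -mulrA ler_wpM2l ?powR_ge0//.
      apply: le_trans (powR_sum_le _ a0 _) _; first by move=> c; exact: envelope_ge0.
      apply: ler_wpM2r; first by apply: sumr_ge0 => c _; exact: powR_ge0.
      by apply: ler_powRl; rewrite ?ler_nat ?(ltW a0).
  rewrite ge0_integralZl//; last 2 first.
  - by apply: emeasurable_sum => c; exact: measurable_envelope_powR.
  - by move=> x _; apply: sume_ge0 => c _; rewrite lee_fin powR_ge0.
  have -> : (N%:R `^ alpha * (N%:R * B) * D `^ alpha)%:E = (K%:E * (N%:R * B)%:E)%E.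
    by rewrite -EFinM; congr EFin; rewrite /K; ring.
  rewrite lee_wpmul2l ?lee_fin// ge0_integral_sum//; last 2 first.
  - by move=> c; exact: measurable_envelope_powR.
  - by move=> c x _; rewrite lee_fin powR_ge0.
  apply: (@le_trans _ _ ((size cs)%:R * B)%:E).
    elim: cs {sN fD} => [|c cs IH]; first by rewrite big_nil mul0r.
    by rewrite big_cons /= -natr1 mulrDl mul1r addrC EFinD leeD.
  by rewrite lee_fin ler_wpM2r// ler_nat.
rewrite /Rintegral; move: I; case: (\int[mu]_x _)%E => //=.
by rewrite !mulr_ge0 ?powR_ge0.
Qed.

Section kernel_increments.
Variables (a alpha gamma lambda : R) (H : R -> R) (C : R).
Hypotheses (l0 : 0 < lambda) (p00 : 0 < a - alpha^-1) (alpha0 : 0 < alpha).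
Hypothesis H_range : forall t, a <= H t <= 2.
Hypothesis H_holder : forall t s, `|t - s| <= 1 -> `|H t - H s| <= C * `|t - s| `^ gamma.

Local Notation G := (ltmfsm_kernel alpha lambda H).
Local Notation E r := (envelope r (lambda / 4)).

Let exponent_itv t : a - alpha^-1 <= H t - alpha^-1 <= 2.
Proof.
have /andP[h1 h2] := H_range t; have : 0 < alpha^-1 by rewrite invr_gt0.
by move=> ?; apply/andP; split; lra.
Qed.

Lemma ltmfsm_kernel_diff m r : 0 <= r -> 0 <= m -> m <= 1 -> m <= gamma ->
  m <= a - alpha^-1 + r ->
  exists2 D, 0 <= D & forall t h x, 0 <= h -> h <= 1 ->
    `|G (t + h) x - G t x|
      <= D * h `^ m * \sum_(c <- [:: t + h; t; 0]) E r (c - x).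
Proof.
move=> r0 m0 m1 mg mpr.
have [D1 D10 H1] := causal_kernel_diff l0 (ltW p00) r0 mpr m0 m1.
have [D2 D20 H2] := causal_kernel_lipschitz_exponent l0 p00 r0.
have C0 : 0 <= C.
  have := @H_holder 1 0; rewrite subr0 normr1 powR1 mulr1 => /(_ (lexx _)).
  exact: le_trans.
exists (D1 + D2 * C); first by rewrite addr_ge0 ?mulr_ge0.
move=> t h x h0 h1; rewrite !big_cons big_nil addr0 !ltmfsm_kernelE.
have /andP[p1 p2] := exponent_itv t; have /andP[q1 q2] := exponent_itv (t + h).
set p := H t - _ in p1 p2 *; set q := H (t + h) - _ in q1 q2 *.
have pq : `|q - p| <= C * h `^ m.
  have -> : q - p = H (t + h) - H t by rewrite /p /q; ring.
  have := @H_holder (t + h) t; have -> : t + h - t = h by ring.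
  rewrite (ger0_norm h0) => /(_ h1)/le_trans; apply.
  rewrite ler_wpM2l//; move: h0; rewrite le_eqVlt => /predU1P[<-|h0].
    have [g0|g0] := eqVneq gamma 0.
      by rewrite g0; have -> : m = 0 by lra.
    by rewrite powR0// powR_ge0.
  have -> : gamma = m + (gamma - m) by ring.
  rewrite powR_D// ler_piMr ?powR_ge0//.
  have := @ler_powRl R (gamma - m) h 1; rewrite powR1; apply => //; lra.
(* Three sources of variation: the shift by h at the new exponent, the change of exponent at t - x,
   and the change of exponent in the compensating term at - x, which is why 0 is among the
   centres. *)
have -> : causal_kernel lambda q (t + h - x) - causal_kernel lambda q (- x) -
    (causal_kernel lambda p (t - x) - causal_kernel lambda p (- x)) =
  (causal_kernel lambda q (t + h - x) - causal_kernel lambda q (t + h - x - h)) +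
  (causal_kernel lambda q (t - x) - causal_kernel lambda p (t - x)) -
  (causal_kernel lambda q (0 - x) - causal_kernel lambda p (0 - x)).
  have -> : t + h - x - h = t - x by ring.
  by rewrite sub0r; ring.
have hm0 : 0 <= h `^ m := powR_ge0 _ _.
have e1 := envelope_ge0 r (lambda / 4) (t + h - x).
have L u : `|causal_kernel lambda q u - causal_kernel lambda p u|
    <= D2 * C * h `^ m * E r u.
  apply: le_trans (H2 _ _ _ q1 q2 p1 p2) _.
  by rewrite -!mulrA ler_wpM2l// mulrA ler_wpM2r// envelope_ge0.
apply: (@le_trans _ _ (D1 * (h `^ m * E r (t + h - x)) + D2 * C * h `^ m * E r (t - x)
    + D2 * C * h `^ m * E r (0 - x))).
  rewrite (le_trans (ler_normB _ _))// lerD//.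
  rewrite (le_trans (ler_normD _ _))// lerD//.
  exact: H1.
have u1 : 0 <= D2 * C * h `^ m * E r (t + h - x) by rewrite !mulr_ge0.
have u2 : 0 <= D1 * h `^ m * E r (t - x) by rewrite !mulr_ge0 ?envelope_ge0.
have u3 : 0 <= D1 * h `^ m * E r (0 - x) by rewrite !mulr_ge0 ?envelope_ge0.
rewrite !mulrDl !mulrDr; lra.
Qed.

(** For m <= 1, subtract two first differences. For m > 1 also gamma > 1, so H is constant; the
    compensating terms cancel because 1 - 2 + 1 = 0, and the second difference of the causal kernel
    alone remains. *)
Lemma ltmfsm_kernel_diff2 m r : 0 <= r -> 0 <= m -> m <= 2 -> m <= gamma ->
  m <= a - alpha^-1 + r ->
  exists2 D, 0 <= D & forall t h x, 0 < h -> h <= 1 ->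
    `|G (t + h *+ 2) x - G (t + h) x *+ 2 + G t x|
      <= D * h `^ m * \sum_(c <- [:: t + h *+ 2; t + h; t; 0]) E r (c - x).
Proof.
move=> r0 m0 m2 mg mpr; have [m1|m1] := leP m 1.
  have [D D0 HD] := ltmfsm_kernel_diff r0 m0 m1 mg mpr.
  exists (D *+ 2); first by rewrite mulrn_wge0.
  move=> t h x h0 h1.
  have -> : G (t + h *+ 2) x - G (t + h) x *+ 2 + G t x =
    (G (t + h + h) x - G (t + h) x) - (G (t + h) x - G t x).
    have -> : t + h *+ 2 = t + h + h by ring.
    by ring.
  apply: le_trans (ler_normB _ _) _.
  apply: le_trans (lerD (HD (t + h) h x (ltW h0) h1) (HD t h x (ltW h0) h1)) _.
  rewrite !big_cons !big_nil !addr0.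
  have -> : t + h *+ 2 = t + h + h by ring.
  have e1 := envelope_ge0 r (lambda / 4) (t + h + h - x).
  have e2 := envelope_ge0 r (lambda / 4) (t - x).
  have hm0 : 0 <= D * h `^ m by rewrite mulr_ge0 ?powR_ge0.
  rewrite -mulrDr mulr2n mulrDl mulrDl -mulrDr ler_wpM2l//; lra.
have Hc := holder_gt1_cst (lt_le_trans m1 mg) H_holder.
have [D D0 HD] := causal_kernel_diff2 l0 (ltW p00) r0 mpr m0 m2.
exists D => // t h x h0 h1; rewrite !big_cons big_nil addr0.
have /andP[p1 p2] := exponent_itv t.
rewrite !ltmfsm_kernelE (Hc (t + h *+ 2) t) (Hc (t + h) t).
have := HD _ h (t + h *+ 2 - x) p1 p2 h0 h1.
have -> : t + h *+ 2 - x - h = t + h - x by ring.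
have -> : t + h *+ 2 - x - h *+ 2 = t - x by ring.
set k3 := causal_kernel _ _ (- x); set k2 := causal_kernel _ _ (t - x).
move=> HH; have -> : causal_kernel lambda (H t - alpha^-1) (t + h *+ 2 - x) - k3 -
  (causal_kernel lambda (H t - alpha^-1) (t + h - x) - k3) *+ 2 + (k2 - k3) =
  causal_kernel lambda (H t - alpha^-1) (t + h *+ 2 - x) -
  causal_kernel lambda (H t - alpha^-1) (t + h - x) *+ 2 + k2 by ring.
apply: (le_trans HH); rewrite mulrA ler_wpM2l ?mulr_ge0 ?powR_ge0//.
by rewrite lerDl !addr_ge0 ?envelope_ge0.
Qed.

End kernel_increments.

End ltmfsm_increments.

(** * Tail bounds from the characteristic function *)

Lemma powRXn {R : realType} (x r : R) n : 0 <= x -> (x `^ r) ^+ n = (x ^+ n) `^ r.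
Proof.
by move=> x0; rewrite -powR_mulrn ?powR_ge0// -powRrM mulrC powRrM powR_mulrn.
Qed.

Section tail.
Context {d : measure_display} {Omega : measurableType d} {R : realType}.
Variable P : probability Omega R.

Lemma nneseries_geometric_le (f : nat -> \bar R) (A z : R) :
  0 <= A -> 0 <= z -> z < 1 -> (forall k, 0 <= f k)%E ->
  (forall k, f k <= (A * z ^+ k)%:E)%E ->
  (\sum_(0 <= k <oo) f k <= (A / (1 - z))%:E)%E.
Proof.
move=> A0 z0 z1 f0 fA; apply: lime_le; first by apply: is_cvg_nneseries.
apply: nearW => n; apply: (@le_trans _ _ (\sum_(0 <= k < n) (A * z ^+ k)%:E)%E).
  by apply: lee_sum.
rewrite sumEFin lee_fin -mulr_sumr ler_wpM2l//.
have zp : 0 < 1 - z by rewrite subr_gt0.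
rewrite -[leRHS]mulr1 ler_pdivlMl// big_mkord.
have := subrX1 z n; have : 0 <= z ^+ n by exact: exprn_ge0.
by move: (\sum_(i < n) z ^+ i) => S; lra.
Qed.

Lemma measurable_norm_ge (Y : Omega -> R) (v : R) : measurable_fun setT Y ->
  measurable [set w | v <= `|Y w|].
Proof.
move=> mY; have mn : measurable_fun setT (fun w => `|Y w|) by exact: measurableT_comp.
have mt : measurable ([set true] : set bool) by [].
have := @measurable_fun_ler _ _ _ setT _ _ (measurable_cst v) mn measurableT _ mt.
by rewrite setTI.
Qed.

Lemma measurable_shell (Y : Omega -> R) (v v' : R) : measurable_fun setT Y ->
  measurable [set w | v <= `|Y w| < v'].
Proof.
move=> mY.
have -> : [set w | v <= `|Y w| < v'] = [set w | v <= `|Y w|] `\` [set w | v' <= `|Y w|].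
  apply/seteqP; split => w /=; first by move=> /andP[-> h]; split => //; apply/negP; rewrite -ltNge.
  by move=> [-> /negP]; rewrite -ltNge.
by apply: measurableD; exact: measurable_norm_ge.
Qed.

(** On the shell |Y| / v lies in [1, 2[, inside [0, pi] where cos decreases, so 1 - cos(Y / v) >= 1
    - cos 1; Markov's inequality concludes. *)
Lemma probability_shell (Y : Omega -> R) (v : R) : measurable_fun setT Y -> 0 < v ->
  ((1 - cos 1)%:E * P [set w | (v <= `|Y w| < 2 * v)%R]
    <= (1 - fine 'E_P[fun w => cos (v^-1 * Y w)])%:E)%E.
Proof.
move=> mY v0.
have mc : measurable_fun setT (fun w => cos (v^-1 * Y w)).
  apply: measurableT_comp; last exact: measurable_funM.
  by apply: continuous_measurable_fun; exact: continuous_cos.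
have ic : P.-integrable setT (EFin \o (fun w => cos (v^-1 * Y w))).
  apply: measurable_bounded_integrable => //.
    by apply: (le_lt_trans (probability_le1 P measurableT)); rewrite ltry.
  exists 1; split; first exact: num_real.
  move=> x x1 w _ /=; apply: le_trans (ltW x1).
  by rewrite ler_norml cos_geN1 cos_le1.
have i1 : P.-integrable setT (EFin \o (cst 1 : Omega -> R)).
  exact: finite_measure_integrable_cst.
have c1 : cos (1 : R) < 1.
  rewrite -[ltRHS]cos0 ltr_cos ?in_itv/= ?lexx ?pi_ge0 ?ler01//.
  by have := pi_ge2 R; lra.
pose g w := (1 - cos (v^-1 * Y w))%:E.
have g0 w : (0 <= g w)%E by rewrite lee_fin subr_ge0 cos_le1.
have mg : measurable_fun setT g by apply/measurable_EFinP; apply: measurable_funB.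
have -> : (1 - fine 'E_P[fun w => cos (v^-1 * Y w)])%:E = (\int[P]_w `|g w|)%E.
  under eq_integral do rewrite gee0_abs//.
  rewrite /g; under eq_integral do rewrite EFinB.
  rewrite (integralB_EFin measurableT i1 ic) EFinB fineK; last first.
    by rewrite unlock; exact: integrable_fin_num.
  rewrite unlock (integral_cst P measurableT 1).
  by congr (_ - _)%E; rewrite mul1e; apply/esym; exact: probability_setT.
have c0 : 0 < 1 - cos (1 : R) by rewrite subr_gt0.
apply: le_trans (@le_integral_abse _ _ _ P _ measurableT g _ mg c0).
rewrite setTI lee_pmul2l ?lte_fin ?subr_gt0// le_measure ?inE//.
- exact: measurable_shell.
- rewrite -[X in measurable X]setTI.
  by apply: emeasurable_fun_c_infty => //; exact: measurableT_comp.
move=> w /= /andP[Yv Y2v]; rewrite lee_fin ger0_norm ?subr_ge0 ?cos_le1// lerD2l lerN2.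
have -> : cos (v^-1 * Y w) = cos (v^-1 * `|Y w|).
  by have [y0|y0] := leP 0 (Y w); [rewrite ger0_norm|rewrite ltr0_norm// mulrN cosN].
have a1 : 1 <= v^-1 * `|Y w| by rewrite ler_pdivlMl// mulr1.
have a2 : v^-1 * `|Y w| < 2 by rewrite ltr_pdivrMl// mulrC.
have p2 := pi_ge2 R.
rewrite leNgt ltr_cos ?in_itv/= -?leNgt//; first by apply/andP; split; lra.
by apply/andP; split; lra.
Qed.

(** The tail is cut into dyadic shells, whose bounds form a geometric series of ratio 2^(- alpha).
    The characteristic function is used only at the points 1 / (u 2^k), so no integration over tau
    occurs. *)
Lemma tail_bound (alpha : R) : 0 < alpha -> exists2 K, 0 <= K &
  forall (Y : Omega -> R) (B : R), measurable_fun setT Y -> 0 <= B ->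
    (forall tau, 0 < tau -> 1 - fine 'E_P[fun w => cos (tau * Y w)] <= B * tau `^ alpha) ->
    forall u, 0 < u -> (P [set w | (u <= `|Y w|)%R] <= (K * B * u `^ (- alpha))%:E)%E.
Proof.
move=> a0.
have c1 : cos (1 : R) < 1.
  rewrite -[ltRHS]cos0 ltr_cos ?in_itv/= ?lexx ?pi_ge0 ?ler01//.
  by have := pi_ge2 R; lra.
have c0 : 0 < 1 - cos (1 : R) by rewrite subr_gt0.
pose z : R := 2 `^ (- alpha).
have z0 : 0 <= z by exact: powR_ge0.
have z1 : z < 1.
  rewrite /z powRN invf_lt1 ?powR_gt0//.
  by have := @gt0_ltr_powR R alpha a0 1 2; rewrite powR1; apply; rewrite ?nnegrE// ltr1n.
have zp : 0 < 1 - z by rewrite subr_gt0.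
exists ((1 - cos 1)^-1 / (1 - z)); first by rewrite mulr_ge0// invr_ge0 ltW.
move=> Y B mY B0 HB u u0.
pose A k := [set w | u * 2 ^+ k <= `|Y w| < 2 * (u * 2 ^+ k)].
have mA k : measurable (A k) by exact: measurable_shell.
have mT : measurable [set w | u <= `|Y w|] by exact: measurable_norm_ge.
apply: le_trans (measure_sigma_subadditive P mA mT _) _.
  move=> w /= uY.
  have ex : exists n, `|Y w| < u * 2 ^+ n.
    exists (Num.bound (u^-1 * `|Y w|)).
    rewrite -ltr_pdivrMl// (lt_le_trans (archi_boundP _))//.
      by rewrite mulr_ge0// invr_ge0 ltW.
    by rewrite -natrX ler_nat ltnW// ltn_expl.
  (* The least n with |Y| < u 2^n is positive because u <= |Y|; its predecessor indexes the
     shell. *)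
  case: (ex_minnP ex) => [[|n] hn hmin].
    by move: hn; rewrite expr0 mulr1 ltNge uY.
  exists n => //; rewrite /A/=; apply/andP; split.
    by rewrite leNgt; apply/negP => /hmin; rewrite ltnn.
  by rewrite mulrCA -exprS.
have -> : (1 - cos 1)^-1 / (1 - z) * B * u `^ (- alpha) =
  ((1 - cos 1)^-1 * (B * u `^ (- alpha))) / (1 - z) by ring.
apply: nneseries_geometric_le => //.
  by rewrite !mulr_ge0 ?powR_ge0// invr_ge0 ltW.
move=> k; set v := u * 2 ^+ k; have v0 : 0 < v by rewrite mulr_gt0// exprn_gt0.
have vi0 : 0 < v^-1 by rewrite invr_gt0.
rewrite -mulrA EFinM lee_pdivlMl//.
apply: le_trans (probability_shell mY v0) _; rewrite lee_fin.
apply: le_trans (HB _ vi0) _.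
rewrite -mulrA ler_wpM2l// -powR_inv1 ?(ltW v0)// -powRrM mulN1r /v powRM ?exprn_ge0 ?(ltW u0)//.
rewrite ler_wpM2l ?powR_ge0//.
by rewrite /z powRXn.
Qed.

End tail.

(** * From tail bounds to almost sure bounds *)

Section almost_sure_bounds.
Context {d : measure_display} {Omega : measurableType d} {R : realType}.
Variable P : probability Omega R.

Lemma powR_neg_arbitrarily_small (K alpha e : R) : 0 <= K -> 0 < alpha -> 0 < e ->
  exists j : nat, K * j.+1%:R `^ (- alpha) <= e.
Proof.
move=> K0 a0 e0; pose q := (K / e) `^ alpha^-1.
have q0 : 0 <= q := powR_ge0 _ _.
exists (Num.bound q).
have qj : q <= (Num.bound q).+1%:R.
  by rewrite (le_trans (ltW (archi_boundP q0)))// ler_nat.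
rewrite powRN ler_pdivrMr ?powR_gt0// -ler_pdivrMl// mulrC.
have -> : K / e = q `^ alpha.
  by rewrite -powRrM mulVf ?gt_eqF// powRr1// divr_ge0// ltW.
by apply: ler_powRl => //; exact: ltW.
Qed.

(* A quantitative Borel-Cantelli argument: the event that the ratios are
   unbounded lies, for each j, in an event of probability O(j^-alpha). *)
Lemma ae_bounded_ratio (V : nat -> nat -> Omega -> R) (N : nat -> nat)
    (r D : nat -> R) (alpha A z : R) :
  0 < alpha -> 0 <= A -> 0 <= z -> z < 1 -> (forall n, 0 < r n) ->
  (forall n k, measurable_fun setT (V n k)) ->
  (forall n k u, (k < N n)%N -> 0 < u ->
     (P [set w | (u * r n <= `|V n k w|)%R] <= (D n * u `^ (- alpha))%:E)%E) ->
  (forall n, (N n)%:R * D n <= A * z ^+ n) ->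
  {ae P, forall w, exists j : nat, forall n k, (k < N n)%N ->
     `|V n k w| <= j%:R * r n}.
Proof.
move=> a0 A0 z0 z1 r0 mV tV ND.
(* The tail bound asks for a positive threshold, hence j + 1. *)
pose U j n := \big[setU/set0]_(k < N n) [set w | j.+1%:R * r n <= `|V n k w|].
have mU j n : measurable (U j n).
  by apply: bigsetU_measurable => k _; exact: measurable_norm_ge.
pose B j := \bigcup_n U j n.
have mB j : measurable (B j) by apply: bigcup_measurable => n _; exact: mU.
have PB j : (P (B j) <= (A / (1 - z) * j.+1%:R `^ (- alpha))%:E)%E.
  apply: le_trans (measure_sigma_subadditive P (mU j) (mB j) (@subset_refl _ _)) _.
  have -> : A / (1 - z) * j.+1%:R `^ (- alpha) = (A * j.+1%:R `^ (- alpha)) / (1 - z) by ring.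
  apply: nneseries_geometric_le => //; first by rewrite mulr_ge0 ?powR_ge0.
  move=> n; apply: (@le_trans _ _ (\sum_(k < N n) (D n * j.+1%:R `^ (- alpha))%:E)%E).
    have := @Boole_inequality _ _ _ P (fun k => [set w | j.+1%:R * r n <= `|V n k w|]) (N n)
      (fun k _ => measurable_norm_ge _ (mV n k)).
    move/le_trans; apply.
    by apply: lee_sum => k _; apply: tV.
  rewrite sumEFin lee_fin sumr_const card_ord -[leLHS]mulr_natl mulrA.
  have -> : A * j.+1%:R `^ (- alpha) * z ^+ n = (A * z ^+ n) * j.+1%:R `^ (- alpha) by ring.
  by rewrite ler_wpM2r ?powR_ge0.
have mbad : measurable (\bigcap_j B j) by apply: bigcap_measurable => // j _; exact: mB.
exists (\bigcap_j B j); split => //.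
- apply/eqP; rewrite eq_le measure_ge0 andbT.
  apply/lee_addgt0Pr => e e0; rewrite add0e.
  have K0 : 0 <= A / (1 - z) by rewrite divr_ge0// subr_ge0 ltW.
  have [j hj] := powR_neg_arbitrarily_small K0 a0 e0.
  apply: (@le_trans _ _ (P (B j))).
    by apply: le_measure; rewrite ?inE//; exact: bigcap_inf.
  by apply: (le_trans (PB j)); rewrite lee_fin.
- move=> w /= nb j _; apply: contrapT => nB; apply: nb.
  exists j.+1 => n k kN; rewrite leNgt; apply/negP => h; apply: nB.
  exists n => //; rewrite /U -(big_mkord xpredT (fun k => [set w | j.+1%:R * r n <= `|V n k w|])) -bigcup_seq.
  by exists k; rewrite /= ?mem_index_iota// ltW.
Qed.

End almost_sure_bounds.

(** * Tails of the increments of the process *)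

Section ltmfsm_tails.
Context {d : measure_display} {Omega : measurableType d} {R : realType}.
Variable P : probability Omega R.
Variables (alpha lambda : R) (H : R -> R) (X : R -> {RV P >-> R}).
Hypotheses (alpha0 : 0 < alpha) (l0 : 0 < lambda) (X_ltmfsm : is_LTmFSM alpha lambda H X).

Local Notation mu := (@lebesgue_measure R).
Local Notation G := (ltmfsm_kernel alpha lambda H).

Lemma measurable_ltmfsm_kernel t : measurable_fun setT (G t : measurableTypeR R -> R).
Proof. by case: X_ltmfsm => c [Z [_ _ /(_ t)[] ]]. Qed.

(** The characteristic function at tau is exp(- J) with J <= B (tau D)^alpha, and 1 - exp(- J) <= J
    is what [tail_bound] takes. K depends neither on the times nor on the coefficients; four
    translates suffice for first and second differences. *)
Lemma ltmfsm_tail r : 0 <= r -> r * alpha < 1 -> exists2 K, 0 <= K &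
  forall (n : nat) (theta t : 'I_n -> R) (cs : seq R) (D : R), 0 <= D -> (size cs <= 4)%N ->
    (forall x, `|\sum_(k < n) theta k * G (t k) x|
       <= D * \sum_(c <- cs) envelope r (lambda / 4) (c - x)) ->
    forall u, 0 < u ->
      (P [set w | (u <= `|\sum_(k < n) theta k * X (t k) w|)%R]
        <= (K * D `^ alpha * u `^ (- alpha))%:E)%E.
Proof.
move=> r0 ra; have l40 : 0 < lambda / 4 by rewrite divr_gt0.
have [B B0 HB] := @Rintegral_envelopes R alpha r (lambda / 4) 4 alpha0 r0 l40 ra.
have [K K0 HK] := tail_bound P alpha0.
exists (K * B); first by rewrite mulr_ge0.
move=> n theta t cs D D0 cs4 hD u u0.
rewrite -(mulrA K); apply: HK => //.
- apply: measurable_sum => k; exact: measurable_funM.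
- by rewrite mulr_ge0// powR_ge0.
move=> tau tau0.
have [c [Z [_ _ _ /(_ n (fun k => tau * theta k) t)] ]] := X_ltmfsm.
rewrite /expect_expi => -[EE _].
have -> : ('E_P[fun w => cos (tau * \sum_(k < n) theta k * X (t k) w)%R] =
   'E_P[fun w => cos (\sum_(k < n) tau * theta k * X (t k) w)%R])%E.
  congr ('E_P[_])%E; apply/funext => w; congr cos.
  by rewrite mulr_sumr; apply: eq_bigr => k _; rewrite mulrA.
rewrite EE.
set J := Rintegral _ _ _.
have HJ : J <= B * (tau * D) `^ alpha.
  apply: (HB _ _ cs) => //.
  - apply: measurable_sum => k; apply: measurable_funM => //.
    exact: measurable_ltmfsm_kernel.
  - by rewrite mulr_ge0// ltW.
  move=> x; have -> : \sum_(k < n) tau * theta k * G (t k) x =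
      tau * \sum_(k < n) theta k * G (t k) x.
    by rewrite mulr_sumr; apply: eq_bigr => k _; rewrite mulrA.
  by rewrite normrM (gtr0_norm tau0) -mulrA ler_wpM2l// ltW.
have := expR_ge1Dx (- J); rewrite powRM ?(ltW tau0)// in HJ.
have -> : B * D `^ alpha * tau `^ alpha = B * (tau `^ alpha * D `^ alpha) by ring.
lra.
Qed.

Variables (a gamma C : R).
Hypotheses (p00 : 0 < a - alpha^-1).
Hypothesis H_range : forall t, a <= H t <= 2.
Hypothesis H_holder : forall t s, `|t - s| <= 1 -> `|H t - H s| <= C * `|t - s| `^ gamma.

(** r is the part of m that the pointwise order a - 1/alpha does not supply; it stays below the
    integrability limit 1/alpha exactly because m < a. *)
Lemma envelope_exponent m : 0 <= m -> m < a -> exists r,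
  [/\ 0 <= r, r * alpha < 1 & m <= a - alpha^-1 + r].
Proof.
move=> m0 ma; exists (Num.max 0 (m - (a - alpha^-1))); split.
- by rewrite le_max lexx.
- rewrite maxEle; case: ifPn => _; last by rewrite mul0r.
  by rewrite -ltr_pdivlMr// mul1r; lra.
- by rewrite maxEle; case: ifPn => [_|]; last (rewrite -ltNge => ?); lra.
Qed.

Lemma ltmfsm_diff_tail m : 0 <= m -> m <= 1 -> m <= gamma -> m < a ->
  exists2 K, 0 <= K & forall t h u, 0 <= h -> h <= 1 -> 0 < u ->
    (P [set w | (u <= `|X (t + h)%R w - X t w|)%R]
       <= (K * (h `^ m) `^ alpha * u `^ (- alpha))%:E)%E.
Proof.
move=> m0 m1 mg ma; have [r [r0 ra mr] ] := envelope_exponent m0 ma.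
have [K K0 HK] := ltmfsm_tail r0 ra.
have [D D0 HD] := ltmfsm_kernel_diff l0 p00 alpha0 H_range H_holder r0 m0 m1 mg mr.
exists (K * D `^ alpha); first by rewrite mulr_ge0 ?powR_ge0.
move=> t h u h0 h1 u0.
pose th (k : 'I_2) : R := if k == ord0 then 1 else - 1.
pose tt (k : 'I_2) := if k == ord0 then t + h else t.
have -> : K * D `^ alpha * (h `^ m) `^ alpha = K * (D * h `^ m) `^ alpha.
  by rewrite powRM ?powR_ge0// mulrA.
have := HK 2%N th tt [:: t + h; t; 0] (D * h `^ m) _ _ _ u u0.
under [X in P X]eq_set do rewrite !big_ord_recl big_ord0 /th /tt /= mul1r mulN1r addr0.
apply => //; first by rewrite mulr_ge0 ?powR_ge0.
move=> x; rewrite !big_ord_recl big_ord0 /th /tt /= mul1r mulN1r addr0.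
exact: HD.
Qed.

Lemma ltmfsm_diff2_tail m : 0 <= m -> m <= 2 -> m <= gamma -> m < a ->
  exists2 K, 0 <= K & forall t h u, 0 < h -> h <= 1 -> 0 < u ->
    (P [set w | (u <= `|X (t + h *+ 2)%R w - X (t + h)%R w *+ 2 + X t w|)%R]
       <= (K * (h `^ m) `^ alpha * u `^ (- alpha))%:E)%E.
Proof.
move=> m0 m2 mg ma; have [r [r0 ra mr] ] := envelope_exponent m0 ma.
have [K K0 HK] := ltmfsm_tail r0 ra.
have [D D0 HD] := ltmfsm_kernel_diff2 l0 p00 alpha0 H_range H_holder r0 m0 m2 mg mr.
exists (K * D `^ alpha); first by rewrite mulr_ge0 ?powR_ge0.
move=> t h u h0 h1 u0.
pose th (k : 'I_3) : R := nth 0 [:: 1; - 2; 1] k.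
pose tt (k : 'I_3) : R := nth 0 [:: t + h *+ 2; t + h; t] k.
have -> : K * D `^ alpha * (h `^ m) `^ alpha = K * (D * h `^ m) `^ alpha.
  by rewrite powRM ?powR_ge0// mulrA.
have E (f : R -> R) : \sum_(k < 3) th k * f (tt k) =
    f (t + h *+ 2) - f (t + h) *+ 2 + f t.
  by rewrite !big_ord_recl big_ord0 /th /tt /=; ring.
have := HK 3%N th tt [:: t + h *+ 2; t + h; t; 0] (D * h `^ m) _ _ _ u u0.
under [X in P X]eq_set => w do rewrite (E (fun s => X s w)).
apply => //; first by rewrite mulr_ge0 ?powR_ge0.
by move=> x; rewrite (E (fun s => G s x)); exact: HD.
Qed.

End ltmfsm_tails.

(** * Dyadic cells and chaining *)

Section dyadic.
Context {R : realType}.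
Implicit Types (x y z : R) (n : nat) (k : int) (M : nat).

Definition dyadic n k : R := k%:~R / 2 ^+ n.

Definition dyadic_cell n x : int := Num.floor (2 ^+ n * x).

Lemma dyadicD1 n k : dyadic n (k + 1) = dyadic n k + 2 ^- n.
Proof. by rewrite /dyadic intrD mulrDl mul1r. Qed.

Lemma dyadicS n k : dyadic n.+1 (2 * k) = dyadic n k.
Proof.
by rewrite /dyadic intrM exprS; field; rewrite expf_neq0.
Qed.

Lemma dyadic_cell_itv n x :
  dyadic n (dyadic_cell n x) <= x < dyadic n (dyadic_cell n x) + 2 ^- n.
Proof.
have /andP[h1 h2] := floor_itv (2 ^+ n * x).
rewrite -dyadicD1 /dyadic ler_pdivrMr ?exprn_gt0// ltr_pdivlMr ?exprn_gt0//.
by rewrite [x * _]mulrC h1 h2.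
Qed.

Lemma dyadic_cell_dyadic n k : dyadic_cell n (dyadic n k) = k.
Proof.
apply: floor_def; rewrite /dyadic mulrC divfK ?expf_neq0// lexx/=.
by rewrite ltr_int; lia.
Qed.

Lemma le_dyadic_cell n : {homo dyadic_cell n : x y / x <= y}.
Proof. by move=> x y xy; apply: le_floor; rewrite ler_pM2l ?exprn_gt0. Qed.

Lemma dyadic_cellS n x : dyadic_cell n.+1 x = 2 * dyadic_cell n x \/
  dyadic_cell n.+1 x = 2 * dyadic_cell n x + 1.
Proof.
have /andP[h1 h2] := floor_itv (2 ^+ n * x).
have /andP[g1 g2] := floor_itv (2 ^+ n.+1 * x).
rewrite /dyadic_cell; set c := Num.floor _ in h1 h2 *; set e := Num.floor _ in g1 g2 *.
rewrite exprS -mulrA in g1 g2.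
have H1 : ((2 * c)%:~R : R) < (e + 1)%:~R by rewrite intrM; lra.
have H2 : (e%:~R : R) < (2 * (c + 1))%:~R by rewrite intrM; lra.
by rewrite !ltr_int in H1 H2; lia.
Qed.

Lemma dyadic_cell_adjacent n x y : x <= y -> y - x <= 2 ^- n ->
  dyadic_cell n y = dyadic_cell n x \/ dyadic_cell n y = dyadic_cell n x + 1.
Proof.
move=> xy yx; have := le_dyadic_cell n xy.
have /andP[h1 h2] := floor_itv (2 ^+ n * x).
have /andP[g1 g2] := floor_itv (2 ^+ n * y).
rewrite /dyadic_cell; set c := Num.floor _ in h1 h2 *; set e := Num.floor _ in g1 g2 *.
move=> ce; have q : 2 ^+ n * (y - x) <= 1 by rewrite -ler_pdivlMl ?exprn_gt0// mulr1.
have H2 : (e%:~R : R) < (c + 2)%:~R by rewrite mulrBr in q; rewrite intrD in h2 *; lra.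
by rewrite ltr_int in H2; lia.
Qed.

(** The end - M is itself a dyadic point of every generation, so rounding down cannot leave the
    half-open interval. *)
Lemma dyadic_cell_inside M n x : - M%:R <= x < M%:R ->
  - M%:R <= dyadic n (dyadic_cell n x) < M%:R.
Proof.
move=> /andP[Mx xM]; have /andP[c1 _] := dyadic_cell_itv n x.
rewrite (le_lt_trans c1 xM) andbT /dyadic ler_pdivlMr ?exprn_gt0//.
have -> : - M%:R * 2 ^+ n = (- (M * 2 ^ n)%:Z)%:~R :> R.
  by rewrite mulrNz -pmulrn natrM natrX mulNr.
rewrite ler_int floor_ge_int mulrNz -pmulrn natrM natrX -mulNr mulrC.
by rewrite ler_pM2l ?exprn_gt0.
Qed.

Lemma cvg_dyadic_cell x : dyadic n (dyadic_cell n x) @[n --> \oo] --> x.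
Proof.
have h : (x - (2^-1) ^+ n) @[n --> \oo] --> x.
  rewrite -[X in _ --> X]subr0; apply: cvgB; first exact: cvg_cst.
  by apply: cvg_expr; rewrite ger0_norm ?invr_ge0// invf_lt1// ltr1n.
apply: (squeeze_cvgr _ h (@cvg_cst _ _ _ _ _)).
apply: nearW => n; have /andP[c1 c2] := dyadic_cell_itv n x.
by rewrite c1 andbT exprVn lerBlDr ltW.
Qed.

(** u is squeezed between u - K rho^n, nondecreasing, and u + K rho^n, nonincreasing, where K = C /
    (1 - rho) gives K rho^n - K rho^(n+1) = C rho^n. The same squeeze yields the rate. *)
Lemma cvg_of_geometric_increments (u : R ^nat) (C rho : R) : 0 <= C -> 0 < rho -> rho < 1 ->
  (forall n, `|u n.+1 - u n| <= C * rho ^+ n) ->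
  cvgn u /\ forall n, `|u n - limn u| <= C / (1 - rho) * rho ^+ n.
Proof.
move=> C0 r0 r1 hu; pose K := C / (1 - rho).
have rp : 0 < 1 - rho by rewrite subr_gt0.
have KC : K * (1 - rho) = C by rewrite /K divfK// gt_eqF.
have K0 : 0 <= K by rewrite divr_ge0// ltW.
pose v := (fun n => u n - K * rho ^+ n) : R ^nat.
pose w := (fun n => u n + K * rho ^+ n) : R ^nat.
have rn n : 0 <= rho ^+ n by rewrite exprn_ge0// ltW.
have step n : K * rho ^+ n - K * rho ^+ n.+1 = C * rho ^+ n by rewrite exprS -KC; ring.
have vh : nondecreasing_seq v.
  apply/nondecreasing_seqP => n; rewrite /v.
  by have := hu n; rewrite ler_norml => /andP[]; have := step n; lra.
have wh : nonincreasing_seq w.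
  apply/nonincreasing_seqP => n; rewrite /w.
  by have := hu n; rewrite ler_norml => /andP[]; have := step n; lra.
have vw n : v n <= w n by rewrite /v /w; have := mulr_ge0 K0 (rn n); lra.
have vc : cvgn v.
  apply: nondecreasing_is_cvgn => //; exists (w 0) => _ [n _ <-].
  by apply: le_trans (vw n) _; apply: wh.
have gc : (K * rho ^+ n) @[n --> \oo] --> (0 : R).
  rewrite -[X in _ --> X](mulr0 K); apply: cvgM; first exact: cvg_cst.
  by apply: cvg_expr; rewrite ger0_norm ?(ltW r0).
have uc : u @ \oo --> limn v.
  have -> : u = (fun n => v n + K * rho ^+ n) by apply/funext => n; rewrite /v subrK.
  by rewrite -[X in _ --> X]addr0; apply: cvgD.
have wc : w @ \oo --> limn v.
  by rewrite -[X in _ --> X]addr0; apply: cvgD.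
have lu : limn u = limn v by apply/cvg_lim.
split; first by apply/cvg_ex; exists (limn v).
move=> n; rewrite -/K lu ler_norml.
have h1 := nondecreasing_cvgn_le vh vc n.
have wcc : cvgn w by apply/cvg_ex; exists (limn v).
have h2 := nonincreasing_cvgn_ge wh wcc n.
have lw : limn w = limn v by apply/cvg_lim.
by rewrite lw in h2; rewrite /v /w in h1 h2; apply/andP; split; lra.
Qed.

Lemma dyadic_scale (t : R) : 0 < t -> t <= 1 -> exists n, t <= 2 ^- n < 2 * t.
Proof.
move=> t0 t1; have ex : exists n, 2 ^- n < 2 * t.
  exists (Num.bound t^-1); rewrite -[ltRHS]invrK ltf_pV2 ?posrE ?invr_gt0 ?mulr_gt0 ?exprn_gt0//.
  have ti0 : 0 <= t^-1 by rewrite invr_ge0 ltW.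
  apply: (@le_lt_trans _ _ t^-1); first by rewrite lef_pV2 ?posrE ?mulr_gt0//; lra.
  rewrite (lt_le_trans (archi_boundP ti0))//.
  by rewrite -natrX ler_nat ltnW// ltn_expl.
case: (ex_minnP ex) => n hn hmin; exists n; rewrite hn andbT.
case: n hn hmin => [|n] hn hmin; first by rewrite expr0 invr1.
rewrite leNgt; apply/negP => h; have : (n.+1 <= n)%N.
  apply: hmin; rewrite exprS invfM in h.
  by rewrite -(@ltr_pM2l _ 2^-1) ?invr_gt0// mulKf// gt_eqF.
by rewrite ltnn.
Qed.

(** S is left abstract because it stands for values at dyadic points in one use and for difference
    quotients in the other. *)
Lemma dyadic_chaining (S : nat -> int -> R) M (C eta : R) : 0 <= C -> 0 < eta ->
  (forall n k, - M%:R <= dyadic n k < M%:R ->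
    [/\ `|S n.+1 (2 * k) - S n k| <= C * (2 `^ (- eta)) ^+ n,
        `|S n.+1 (2 * k + 1) - S n k| <= C * (2 `^ (- eta)) ^+ n
      & `|S n (k + 1) - S n k| <= C * (2 `^ (- eta)) ^+ n]) ->
  exists2 K, 0 <= K &
    (forall x, - M%:R <= x < M%:R -> cvgn (fun n => S n (dyadic_cell n x)) /\
       forall n, `|S n (dyadic_cell n x) - limn (fun n => S n (dyadic_cell n x))|
         <= K * (2 `^ (- eta)) ^+ n) /\
    (forall x y, - M%:R <= x < M%:R -> - M%:R <= y < M%:R -> `|x - y| <= 1 ->
       `|limn (fun n => S n (dyadic_cell n x)) - limn (fun n => S n (dyadic_cell n y))|
         <= K * `|x - y| `^ eta).
Proof.
move=> C0 eta0 hS; set rho := 2 `^ (- eta) in hS *.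
have r0 : 0 < rho by rewrite powR_gt0.
have r1 : rho < 1.
  rewrite /rho powRN invf_lt1 ?powR_gt0//.
  by have := @gt0_ltr_powR R eta eta0 1 2; rewrite powR1; apply; rewrite ?nnegrE// ltr1n.
have rp : 0 < 1 - rho by rewrite subr_gt0.
pose g x := limn (fun n => S n (dyadic_cell n x)).
have G x : - M%:R <= x < M%:R -> cvgn (fun n => S n (dyadic_cell n x)) /\
    forall n, `|S n (dyadic_cell n x) - g x| <= C / (1 - rho) * rho ^+ n.
  move=> xM; apply: cvg_of_geometric_increments => // n.
  have [h1 h2 _] := hS n _ (dyadic_cell_inside n xM).
  by have [->|->] := dyadic_cellS n x.
(* Two approximation errors and one step between adjacent cells. *)
pose L := 2 * (C / (1 - rho)) + C.
have Q0 : 0 <= C / (1 - rho) by rewrite divr_ge0// ltW.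
have L0 : 0 <= L by rewrite /L; lra.
have e2 : 1 <= 2 `^ eta :> R.
  by have := @ler_powR R 2 _ 0 eta; rewrite powRr0; apply; rewrite ?ler1n// ltW.
have L2 : L <= L * 2 `^ eta by rewrite ler_peMr.
exists (L * 2 `^ eta); first by rewrite mulr_ge0 ?powR_ge0.
split.
  move=> x xM; have [g1 g2] := G x xM; split => // n; apply: (le_trans (g2 n)).
  by rewrite ler_wpM2r ?exprn_ge0 ?(ltW r0)//; rewrite /L in L2 *; lra.
move=> x y; rewrite -/(g x) -/(g y).
wlog xy : x y / x <= y.
  move=> W xM yM; have [xy|/ltW yx] := leP x y; first exact: W.
  by rewrite (distrC x) (distrC (g x)); apply: W.
move=> xM yM; have [->|xny] := eqVneq x y.
  by rewrite !subrr normr0 mulr_ge0 ?powR_ge0// mulr_ge0 ?powR_ge0.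
have yx0 : 0 < y - x by rewrite subr_gt0 lt_neqAle xny.
rewrite (distrC x) (gtr0_norm yx0) => yx1.
(* At the generation n with 2^-n comparable to y - x, the points x and y lie in
   the same cell or in adjacent cells. *)
have [n /andP[n1 n2] ] := dyadic_scale yx0 yx1.
have [_ gx] := G x xM; have [_ gy] := G y yM.
have xyn : `|S n (dyadic_cell n x) - S n (dyadic_cell n y)| <= C * rho ^+ n.
  have [->|->] := dyadic_cell_adjacent xy n1.
    by rewrite subrr normr0 mulr_ge0// exprn_ge0// ltW.
  by rewrite distrC; have [] := hS n _ (dyadic_cell_inside n xM).
have E : rho ^+ n <= 2 `^ eta * (y - x) `^ eta.
  rewrite -powRM ?(ltW yx0)//.
  have -> : rho ^+ n = (2 ^- n) `^ eta.
    rewrite -powR_mulrn ?powR_ge0// -powRrM -(@powR_mulrn R 2)// -powRN -powRrM.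
    by congr (_ `^ _); ring.
  by apply: ler_powRl; rewrite ?invr_ge0 ?exprn_ge0// ltW.
apply: (@le_trans _ _ (L * rho ^+ n)); last by rewrite -mulrA ler_wpM2l.
have -> : g x - g y = (S n (dyadic_cell n x) - S n (dyadic_cell n y)) -
  (S n (dyadic_cell n x) - g x) + (S n (dyadic_cell n y) - g y) by ring.
have := gx n; have := gy n => hy hx.
apply: le_trans (ler_normD _ _) _.
have -> : L * rho ^+ n = C * rho ^+ n + C / (1 - rho) * rho ^+ n + C / (1 - rho) * rho ^+ n.
  by rewrite /L; ring.
by rewrite lerD//; apply: le_trans (ler_normB _ _) _; rewrite lerD.
Qed.

End dyadic.

(** * Local Hölder conditions *)

Section local_holder.
Context {R : realType}.
Implicit Types (x y z : R) (n : nat) (k : int) (M : nat).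

(** The half-open intervals match the dyadic cells, and distances up to 1 are those that chaining
    reaches. *)
Definition holder_locally (eta : R) (g : R -> R) : Prop :=
  forall M, exists2 K, 0 <= K & forall x y,
    - M%:R <= x < M%:R -> - M%:R <= y < M%:R -> `|x - y| <= 1 ->
    `|g x - g y| <= K * `|x - y| `^ eta.

Lemma powR_small (K eta e : R) : 0 <= K -> 0 < eta -> 0 < e ->
  exists2 delta, 0 < delta <= 1 & forall t, 0 <= t -> t <= delta -> K * t `^ eta <= e.
Proof.
move=> K0 eta0 e0; have K1 : 0 < K + 1 by lra.
have q0 : 0 < (e / (K + 1)) `^ eta^-1 by rewrite powR_gt0// divr_gt0.
exists (Num.min 1 ((e / (K + 1)) `^ eta^-1)).
  by rewrite lt_min ltr01 q0/= ge_min lexx.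
move=> t t0; rewrite le_min => /andP[_ tq].
have : t `^ eta <= e / (K + 1).
  have -> : e / (K + 1) = ((e / (K + 1)) `^ eta^-1) `^ eta.
    by rewrite -powRrM mulVf ?gt_eqF// powRr1// divr_ge0 ?ltW.
  by apply: ler_powRl => //; exact: ltW.
rewrite ler_pdivlMr// => h; have := powR_ge0 t eta; lra.
Qed.

Lemma near_inside x : exists M, forall y, `|x - y| <= 1 -> - M%:R <= y < M%:R.
Proof.
have b : `|x| + 2 < (Num.bound (`|x| + 2))%:R by apply: archi_boundP; rewrite addr_ge0.
exists (Num.bound (`|x| + 2)) => y; rewrite ler_norml => /andP[y1 y2].
have := ler_norm x; have := ler_norm (- x); rewrite normrN => x1 x2.
by apply/andP; split; lra.
Qed.

Lemma holder_locally_continuous (eta : R) (g : R -> R) : 0 < eta ->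
  holder_locally eta g -> continuous g.
Proof.
move=> eta0 hg x; have [M HM] := near_inside x.
have [K K0 HK] := hg M; apply/cvgrPdist_le => e e0.
have [delta /andP[d0 d1] hd] := powR_small K0 eta0 e0.
near=> y; have xy : `|x - y| <= delta by near: y; apply: (@cvgr_dist_le _ _ _ _ _ id).
have xx : - M%:R <= x < M%:R by apply: HM; rewrite subrr normr0.
have yy : - M%:R <= y < M%:R by apply: HM; apply: le_trans d1.
apply: le_trans (HK _ _ xx yy (le_trans xy d1)) _.
exact: hd.
Unshelve. all: end_near. Qed.

Lemma is_derive_holder (eta : R) (g s : R -> R) : 1 < eta ->
  (forall M, exists2 K, 0 <= K & forall x y,
    - M%:R <= x < M%:R -> - M%:R <= y < M%:R -> `|x - y| <= 1 ->
    `|g y - g x - s x * (y - x)| <= K * `|x - y| `^ eta) ->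
  forall x : R, is_derive x 1 g (s x).
Proof.
move=> eta1 hg x; have [M HM] := near_inside x.
have [K K0 HK] := hg M.
have e10 : 0 < eta - 1 by rewrite subr_gt0.
have cv : h^-1 *: (g (h *: 1 + x) - g x) @[h --> 0^'] --> s x.
  apply/cvgrPdist_le => e e0.
  have [delta /andP[d0 d1] hd] := powR_small K0 e10 e0.
  near=> h; have hn0 : h != 0 by near: h; exact: nbhs_dnbhs_neq.
  have hdl : `|h| <= delta.
    near: h; apply: dnbhs0_le => //.
  have E : `|x - (h + x)| = `|h| by rewrite -normrN; congr `|_|; ring.
  have xx : - M%:R <= x < M%:R by apply: HM; rewrite subrr normr0.
  have yy : - M%:R <= h + x < M%:R by apply: HM; rewrite E; apply: le_trans d1.
  have := HK _ _ xx yy; rewrite E => /(_ (le_trans hdl d1)).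
  have -> : h + x - x = h by ring.
  have h0 : 0 < `|h| by rewrite normr_gt0.
  have -> : s x - h^-1 *: (g (h *: 1 + x) - g x) = - (h^-1 * (g (h + x) - g x - s x * h)).
    by rewrite /GRing.scale/= mulr1; field.
  rewrite normrN normrM normfV => H; rewrite ler_pdivrMl//.
  apply: (le_trans H); rewrite [leRHS]mulrC.
  have -> : eta = (eta - 1) + 1 by ring.
  rewrite powR_D// powRr1// mulrA ler_pM2r//.
  exact: hd.
have dv : derivable g x 1 by apply/cvg_ex; exists (s x).
by apply: DeriveDef => //; exact/cvg_lim.
Unshelve. all: end_near. Qed.

(** The segment from s to t is cut into 2 M + 1 steps of length at most 1, and their number enters
    the constant. On such short steps the exponent may be lowered from eta to beta. *)
Lemma holder_on_of_locally (beta eta : R) (g : R -> R) (A : set R) : 0 < beta -> beta <= eta ->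
  holder_locally eta g -> compact A -> holder_on beta A g.
Proof.
move=> b0 be hg cA.
have [M HM] : exists M, forall x, A x -> - M%:R <= x < M%:R.
  have [B [Br HB] ] := compact_bounded cA.
  pose B1 := `|B| + 1; have BB1 : B < B1 by have := ler_norm B; rewrite /B1; lra.
  have B10 : 0 <= B1 by rewrite addr_ge0.
  exists (Num.bound B1) => x /(HB _ BB1) /= h; have b1 := archi_boundP B10.
  by move: h; rewrite ler_norml => /andP[]; move=> h1 h2; apply/andP; split; lra.
have [K K0 HK] := hg M.
exists (K * (M.*2.+1)%:R * 1) => s t /HM sM /HM tM; rewrite mulr1.
pose N := M.*2.+1; have N0 : 0 < N%:R :> R by [].
pose e := (t - s) / N%:R.
have ts : `|t - s| <= N%:R.
  have -> : N%:R = M%:R + M%:R + 1 :> R by rewrite /N -addn1 natrD -addnn natrD.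
  move: sM tM; move: (M%:R : R) => m /andP[s1 s2] /andP[t1 t2].
  by rewrite ler_norml; apply/andP; split; lra.
have e1 : `|e| <= 1 by rewrite normrM normfV (gtr0_norm N0) ler_pdivrMr// mul1r.
have ets : `|e| <= `|t - s|.
  by rewrite normrM normfV (gtr0_norm N0) ler_pdivrMr// ler_peMr// ler1n.
have eN : N%:R * e = t - s by rewrite mulrC divfK// gt_eqF.
have ins i : (i <= N)%N -> - M%:R <= s + i%:R * e < M%:R.
  move=> iN; have iR : i%:R <= N%:R :> R by rewrite ler_nat.
  have i0 : 0 <= i%:R :> R by [].
  have -> : s + i%:R * e = (1 - i%:R / N%:R) * s + (i%:R / N%:R) * t.
    by rewrite /e; field; rewrite gt_eqF.
  set l := i%:R / N%:R; have l0 : 0 <= l by rewrite divr_ge0.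
  have l1 : l <= 1 by rewrite ler_pdivrMr// mul1r.
  move: sM tM => /andP[s1 s2] /andP[t1 t2].
  have l1' : 0 <= 1 - l by rewrite subr_ge0.
  have a1 : 0 <= (1 - l) * (s + M%:R) by rewrite mulr_ge0//; lra.
  have a2 : 0 <= l * (t + M%:R) by rewrite mulr_ge0//; lra.
  have a3 : 0 <= (1 - l) * (M%:R - s) by rewrite mulr_ge0//; lra.
  apply/andP; split; first by lra.
  have [l00|ln0] := eqVneq l 0; first by rewrite l00; lra.
  have a4 : 0 < l * (M%:R - t) by rewrite mulr_gt0 ?subr_gt0// lt_neqAle eq_sym ln0.
  lra.
have eb : `|e| `^ eta <= `|t - s| `^ beta.
  have [e00|en0] := eqVneq e 0; first by rewrite e00 normr0 powR0 ?powR_ge0// gt_eqF// (lt_le_trans b0).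
  apply: (@le_trans _ _ (`|e| `^ beta)); last by apply: ler_powRl => //; exact: ltW.
  have -> : eta = beta + (eta - beta) by ring.
  rewrite powR_D ?normr_gt0// ler_piMr ?powR_ge0//.
  by have := @ler_powRl R (eta - beta) `|e| 1; rewrite powR1; apply => //; rewrite subr_ge0.
have T i : (i <= N)%N -> `|g (s + i%:R * e) - g s| <= i%:R * (K * `|t - s| `^ beta).
  elim: i => [|i IH] iN; first by rewrite !mul0r addr0 subrr normr0.
  have := IH (ltnW iN) => {}IH.
  have -> : g (s + i.+1%:R * e) - g s =
    (g (s + i.+1%:R * e) - g (s + i%:R * e)) + (g (s + i%:R * e) - g s) by ring.
  apply: le_trans (ler_normD _ _) _; rewrite -[X in _ <= X%:R * _]addn1 natrD mulrDl addrC lerD// mul1r.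
  have := HK _ _ (ins _ iN) (ins _ (ltnW iN)).
  have -> : s + i.+1%:R * e - (s + i%:R * e) = e by rewrite -addn1 natrD; ring.
  by move=> /(_ e1) /le_trans; apply; rewrite ler_wpM2l.
have := T N (leqnn _); rewrite eN.
have -> : s + (t - s) = t by ring.
move/le_trans; apply.
by rewrite mulrCA mulrA.
Qed.

End local_holder.

Lemma int_offset (M : nat) (c : int) : - M%:Z <= c -> c < M%:Z ->
  exists i : nat, (i < 2 * M)%N /\ c = i%:Z - M%:Z.
Proof. by move=> *; exists (absz (c + M%:Z)); split; lia. Qed.

Lemma int_le_offset (c e : int) : c <= e -> exists i : nat, e = c + i%:Z.
Proof. by move=> *; exists (absz (e - c)); lia. Qed.

(** * From dyadic second differences to Hölder regularity *)

Section dyadic_holder.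
Context {R : realType}.
Implicit Types (x y z : R) (n : nat) (k : int) (M : nat).
Variable f : R -> R.

Local Notation F n k := (f (dyadic n k)).

Definition dyadic_limit x : R := limn (fun n => f (dyadic n (dyadic_cell n x))).

Definition dyadic_diff2_le (eta : R) : Prop := forall M, exists2 C, 0 <= C &
  forall n k, - M%:R <= (dyadic n k : R) < M%:R ->
    `|F n (k + 2) - F n (k + 1) *+ 2 + F n k| <= C * (2 `^ (- eta)) ^+ n.

Lemma dyadic_diff2_weaken (eta eta' : R) : eta' <= eta ->
  dyadic_diff2_le eta -> dyadic_diff2_le eta'.
Proof.
move=> ee h M; have [C C0 HC] := h M; exists C => // n k /HC /le_trans; apply.
rewrite ler_wpM2l// lerXn2r ?nnegrE ?powR_ge0//.
by apply: ler_powR; rewrite ?ler1n// lerN2.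
Qed.

(** A second difference centred at the midpoint of a cell measures how unequally the two halves
    share the increment over that cell. *)
Let parent_split n k :
  F n.+1 (2 * k + 1) - F n.+1 (2 * k) =
    (F n (k + 1) - F n k - (F n.+1 (2 * k + 2) - F n.+1 (2 * k + 1) *+ 2 + F n.+1 (2 * k))) / 2 /\
  F n.+1 (2 * k + 1 + 1) - F n.+1 (2 * k + 1) =
    (F n (k + 1) - F n k + (F n.+1 (2 * k + 2) - F n.+1 (2 * k + 1) *+ 2 + F n.+1 (2 * k))) / 2.
Proof.
have E2 : 2 * k + 2 = 2 * (k + 1) by ring.
have E3 : 2 * k + 1 + 1 = 2 * (k + 1) by ring.
by rewrite E3 E2 !dyadicS; split; field.
Qed.

(** By [parent_split] an increment is at most half the sum of the parent increment and a second
    difference. The induction closes when A + C rho <= 2 rho A, which is solvable because eta < 1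
    means 2 rho > 1. *)
Lemma dyadic_diff_le (eta : R) : 0 < eta -> eta < 1 -> dyadic_diff2_le eta ->
  forall M, exists2 A, 0 <= A & forall n k, - M%:R <= (dyadic n k : R) < M%:R ->
    `|F n (k + 1) - F n k| <= A * (2 `^ (- eta)) ^+ n.
Proof.
move=> e0 e1 h M; have [C C0 HC] := h M; set rho := 2 `^ (- eta) in HC *.
have r0 : 0 < rho by rewrite powR_gt0.
have r2 : 0 < 2 * rho - 1.
  rewrite subr_gt0 /rho -[X in X * _](@powRr1 R)// -powR_D//.
  have := @gt0_ltr_powR R (1 - eta); rewrite subr_gt0 => /(_ e1 1 2).
  by rewrite powR1; apply; rewrite ?nnegrE// ltr1n.
pose A0 := \sum_(i < 2 * M) `|F 0 (i%:Z - M%:Z + 1) - F 0 (i%:Z - M%:Z)|.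
have A00 : 0 <= A0 by apply: sumr_ge0.
(* A0 covers generation 0; the second term closes the induction step. *)
pose A := A0 + C * rho / (2 * rho - 1).
have Q0 : 0 <= C * rho / (2 * rho - 1) by rewrite divr_ge0 ?mulr_ge0 ?(ltW r0) ?(ltW r2).
have A_ge0 : 0 <= A by rewrite addr_ge0.
have AC : A + C * rho <= 2 * rho * A.
  have : C * rho <= A * (2 * rho - 1).
    by rewrite /A mulrDl divfK ?gt_eqF// lerDr mulr_ge0// ltW.
  lra.
exists A => // n k nk.
(* The induction follows a point x rather than an index k: the parent of the cell of x is the cell
   of x one generation earlier. *)
have W : forall x, - M%:R <= x < M%:R ->
    `|F n (dyadic_cell n x + 1) - F n (dyadic_cell n x)| <= A * rho ^+ n.
  elim: n {k nk} => [|n IH] x xM.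
    rewrite expr0 mulr1; have := dyadic_cell_inside 0 xM.
    set c := dyadic_cell 0 x => /andP[]; rewrite {1 2}/dyadic expr0 divr1 => c1 c2.
    have c1' : - M%:Z <= c by rewrite -(ler_int R) mulrNz.
    have c2' : c < M%:Z by rewrite -(ltr_int R).
    have [i [iM cE] ] := int_offset c1' c2'.
    apply: (@le_trans _ _ A0); last by rewrite /A lerDl.
    rewrite /A0 (bigD1 (Ordinal iM))//= -cE.
    by rewrite lerDl; apply: sumr_ge0.
  have cM := dyadic_cell_inside n xM; have {}IH := IH x xM.
  set c := dyadic_cell n x in cM IH.
  have := HC n.+1 (2 * c); rewrite dyadicS => /(_ cM).
  set e := _ + f (dyadic n c) => he.
  have [p1 p2] := parent_split n c; rewrite dyadicS -/e in p1 p2.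
  have bnd : (`|F n (c + 1) - F n c| + `|e|) / 2 <= A * rho ^+ n.+1.
    rewrite ler_pdivrMr//; apply: le_trans (lerD IH he) _; rewrite exprS.
    have -> : A * rho ^+ n + C * (rho * rho ^+ n) = (A + C * rho) * rho ^+ n by ring.
    have -> : A * (rho * rho ^+ n) * 2 = (2 * rho * A) * rho ^+ n by ring.
    by rewrite ler_wpM2r// exprn_ge0// ltW.
  have [->|->] := dyadic_cellS n x; rewrite -/c; apply: le_trans bnd.
    rewrite dyadicS p1 normrM [`|2^-1|]ger0_norm// ler_wpM2r//.
    exact: ler_normB.
  rewrite p2 normrM [`|2^-1|]ger0_norm// ler_wpM2r//.
  exact: ler_normD.
by have := W _ nk; rewrite dyadic_cell_dyadic.
Qed.

Lemma dyadic_holder_lt1 (eta : R) : 0 < eta -> eta < 1 -> dyadic_diff2_le eta ->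
  (forall x, cvgn (fun n => f (dyadic n (dyadic_cell n x)))) /\
  holder_locally eta dyadic_limit.
Proof.
move=> e0 e1 h.
have W M : exists2 K, 0 <= K &
    (forall x, - M%:R <= x < M%:R -> cvgn (fun n => f (dyadic n (dyadic_cell n x)))) /\
    (forall x y, - M%:R <= x < M%:R -> - M%:R <= y < M%:R -> `|x - y| <= 1 ->
       `|dyadic_limit x - dyadic_limit y| <= K * `|x - y| `^ eta).
  have [A A0 HA] := dyadic_diff_le e0 e1 h M.
  have [n k nk|K K0 [K1 K2] ] := @dyadic_chaining R (fun n k => F n k) M A eta A0 e0.
    split.
    - by rewrite dyadicS subrr normr0 mulr_ge0 ?exprn_ge0 ?powR_ge0.
    - have := HA n.+1 (2 * k); rewrite dyadicS => /(_ nk) /le_trans; apply.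
      rewrite ler_wpM2l// exprS ler_piMl ?exprn_ge0 ?powR_ge0//.
      by have := @ler_powR R 2 _ (- eta) 0; rewrite powRr0; apply; rewrite ?ler1n// oppr_le0 ltW.
    - exact: HA.
  by exists K => //; split=> // x /K1[].
split.
  move=> x; have [M HM] := near_inside x; have [K _ [K1 _] ] := W M.
  by apply: K1; apply: HM; rewrite subrr normr0.
by move=> M; have [K K0 [_ K2] ] := W M; exists K.
Qed.

(** Passing from a cell to a child changes the difference quotient by 2^n times a second difference,
    so the quotients chain with order eta - 1; their limit s is the future derivative. The Taylor
    remainder comes from summing quotients minus s x over the cells between x and y. *)
Lemma dyadic_holder_gt1 (eta : R) : 1 < eta -> dyadic_diff2_le eta ->
  exists s : R -> R, holder_locally (eta - 1) s /\
    forall M, exists2 K, 0 <= K & forall x y,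
      - M%:R <= x < M%:R -> - M%:R <= y < M%:R -> `|x - y| <= 1 ->
      `|dyadic_limit y - dyadic_limit x - s x * (y - x)| <= K * `|x - y| `^ eta.
Proof.
move=> e1 h; have e10 : 0 < eta - 1 by rewrite subr_gt0.
(* Any exponent below 1 would do: only the convergence of the values is wanted here. *)
have [|||Ycvg _] := @dyadic_holder_lt1 2^-1; [lra|lra| |].
  by apply: dyadic_diff2_weaken h; lra.
pose S n k := 2 ^+ n * (F n (k + 1) - F n k).
pose s x := limn (fun n => S n (dyadic_cell n x)).
have W M : exists2 K, 0 <= K &
   (forall x, - M%:R <= x < M%:R -> cvgn (fun n => S n (dyadic_cell n x)) /\
       forall n, `|S n (dyadic_cell n x) - s x| <= K * (2 `^ (- (eta - 1))) ^+ n) /\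
   (forall x y, - M%:R <= x < M%:R -> - M%:R <= y < M%:R -> `|x - y| <= 1 ->
       `|s x - s y| <= K * `|x - y| `^ (eta - 1)).
  have [C C0 HC] := h M; apply: (dyadic_chaining C0 e10) => n k nk.
  have rr : 2 `^ (- (eta - 1)) = 2 * 2 `^ (- eta) :> R.
    by rewrite -[X in X * _](@powRr1 R)// -powR_D//; congr (_ `^ _); ring.
  have r0 : 0 <= 2 `^ (- eta) :> R by exact: powR_ge0.
  have r1 : 2 `^ (- eta) <= 1 :> R.
    by have := @ler_powR R 2 _ (- eta) 0; rewrite powRr0; apply; rewrite ?ler1n//; lra.
  have rn : 0 <= (2 `^ (- eta)) ^+ n :> R by exact: exprn_ge0.
  have [p1 p2] := parent_split n k.
  have := HC n.+1 (2 * k); rewrite dyadicS => /(_ nk).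
  rewrite /S dyadicS in p1 p2 *.
  set e := _ + f (dyadic n k) in p1 p2 * => he.
  have le : 2 ^+ n * `|e| <= C * (2 `^ (- (eta - 1))) ^+ n.
    rewrite rr exprMn mulrCA ler_wpM2l ?exprn_ge0//; apply: (le_trans he).
    by rewrite ler_wpM2l// exprS ler_piMl.
  rewrite p1 p2 exprS; split.
  - apply: le_trans le; rewrite -[leLHS]normrN.
    have -> : - (2 * 2 ^+ n * ((f (dyadic n (k + 1)) - f (dyadic n k) - e) / 2) -
       2 ^+ n * (f (dyadic n (k + 1)) - f (dyadic n k))) = 2 ^+ n * e by field.
    by rewrite normrM ger0_norm ?exprn_ge0.
  - apply: le_trans le.
    have -> : (2 * 2 ^+ n * ((f (dyadic n (k + 1)) - f (dyadic n k) + e) / 2) -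
       2 ^+ n * (f (dyadic n (k + 1)) - f (dyadic n k))) = 2 ^+ n * e by field.
    by rewrite normrM ger0_norm ?exprn_ge0.
  - have := HC n k nk; have -> : k + 2 = k + 1 + 1 by ring.
    move=> hh; rewrite rr exprMn mulrCA -mulrBr normrM ger0_norm ?exprn_ge0//.
    rewrite ler_wpM2l ?exprn_ge0//; apply: le_trans hh.
    by rewrite le_eqVlt; apply/orP; left; apply/eqP; congr `|_|; ring.
exists s; split; first by move=> M; have [K K0 [_ K2] ] := W M; exists K.
move=> M; have [K K0 [K1 K2] ] := W M.
(* The base point is first the left one; the other order is recovered at the end through s y - s x,
   which doubles the constant. *)
have half x y : x <= y -> - M%:R <= x < M%:R -> - M%:R <= y < M%:R -> y - x <= 1 ->
    `|dyadic_limit y - dyadic_limit x - s x * (y - x)| <= K * (y - x) `^ (eta - 1) * (y - x).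
  move=> xy xM yM yx1.
  have yx0 : 0 <= y - x by rewrite subr_ge0.
  pose d n : R := dyadic n (dyadic_cell n y) - dyadic n (dyadic_cell n x).
  pose rho := 2 `^ (- (eta - 1)) : R.
  have step n : `|f (dyadic n (dyadic_cell n y)) - f (dyadic n (dyadic_cell n x)) - s x * d n|
      <= (K * rho ^+ n + K * (y - x) `^ (eta - 1)) * d n.
    have : exists N : nat, dyadic_cell n y = dyadic_cell n x + N%:Z.
      exact: int_le_offset (le_dyadic_cell n xy).
    case=> N cN; rewrite /d cN.
    have B i : (i < N)%N -> `|S n (dyadic_cell n x + i%:Z) - s x|
        <= K * rho ^+ n + K * (y - x) `^ (eta - 1).
      move=> iN; have rn : 0 <= K * rho ^+ n by rewrite mulr_ge0// exprn_ge0// powR_ge0.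
      have yn : 0 <= K * (y - x) `^ (eta - 1) by rewrite mulr_ge0// powR_ge0.
      (* The first cell may start to the left of x, so its quotient is compared with s x directly;
         the left ends of the later cells lie in [x, y]. *)
      case: i iN => [|i] iN.
        by rewrite addr0; have [_ /(_ n) hh] := K1 x xM; apply: (le_trans hh); rewrite lerDl.
      pose z : R := dyadic n (dyadic_cell n x + i.+1%:Z).
      have zE : dyadic_cell n z = dyadic_cell n x + i.+1%:Z := dyadic_cell_dyadic _ _.
      have zx : x <= z.
        rewrite leNgt; apply/negP => /ltW /(le_dyadic_cell n); by rewrite zE gerDl.
      have zy : z <= y.
        rewrite leNgt; apply/negP => yz; have := dyadic_cell_itv n y => /andP[yy _].
        move: (le_lt_trans yy yz); rewrite /z /dyadic ltr_pM2r ?invr_gt0 ?exprn_gt0// ltr_int cN.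
        by rewrite ltrD2l ltz_nat ltnNge (ltnW iN).
      have zM : - M%:R <= z < M%:R.
        by move: xM yM => /andP[x1 x2] /andP[y1 y2]; apply/andP; split; lra.
      rewrite -zE; have -> : S n (dyadic_cell n z) - s x = (S n (dyadic_cell n z) - s z) + (s z - s x) by ring.
      apply: le_trans (ler_normD _ _) _; apply: lerD.
        by have [_ /(_ n) hh] := K1 z zM.
      have zx1 : `|z - x| <= 1 by rewrite ger0_norm; lra.
      apply: le_trans (K2 z x zM xM zx1) _; rewrite ler_wpM2l//.
      by rewrite ger0_norm ?subr_ge0//; apply: ler_powRl; lra.
    set c := dyadic_cell n x in B *; set E := K * rho ^+ n + _ in B *.
    have T i : (i <= N)%N -> `|f (dyadic n (c + i%:Z)) - f (dyadic n c)
        - s x * (dyadic n (c + i%:Z) - dyadic n c)| <= E * (dyadic n (c + i%:Z) - dyadic n c).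
      elim: i => [|i IH] iN; first by rewrite addr0 !subrr !mulr0 subrr normr0.
      have {}IH := IH (ltnW iN).
      have cE : c + i.+1%:Z = c + i%:Z + 1 by rewrite -addrA -addn1 PoszD.
      rewrite cE; set c' := c + i%:Z in IH *.
      have q0 : 0 < 2 ^- n :> R by rewrite invr_gt0 exprn_gt0.
      have -> : f (dyadic n (c' + 1)) - f (dyadic n c) - s x * (dyadic n (c' + 1) - dyadic n c) =
        (f (dyadic n c') - f (dyadic n c) - s x * (dyadic n c' - dyadic n c)) +
        2 ^- n * (S n c' - s x).
        rewrite [2 ^- n * _]mulrBr /S mulKf ?expf_neq0//.
        by rewrite [X in s x * (X - _)]dyadicD1; ring.
      apply: le_trans (ler_normD _ _) _.
      have -> : E * (dyadic n (c' + 1) - dyadic n c) =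
        E * (dyadic n c' - dyadic n c) + 2 ^- n * E by rewrite dyadicD1; ring.
      rewrite lerD// normrM gtr0_norm// ler_pM2l//.
      exact: B.
    exact: T.
  have dcv : d n @[n --> \oo] --> y - x.
    by apply: cvgB; exact: cvg_dyadic_cell.
  have lhs : `|f (dyadic n (dyadic_cell n y)) - f (dyadic n (dyadic_cell n x)) - s x * d n| @[n --> \oo]
     --> `|dyadic_limit y - dyadic_limit x - s x * (y - x)|.
    apply: cvg_norm; apply: cvgB; first by apply: cvgB; exact: Ycvg.
    by apply: cvgM => //; exact: cvg_cst.
  have rhs : (K * rho ^+ n + K * (y - x) `^ (eta - 1)) * d n @[n --> \oo]
     --> (K * 0 + K * (y - x) `^ (eta - 1)) * (y - x).
    apply: cvgM => //; apply: cvgD; last exact: cvg_cst.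
    apply: cvgM; first exact: cvg_cst.
    apply: cvg_expr; rewrite ger0_norm ?powR_ge0// /rho powRN invf_lt1 ?powR_gt0//.
    by have := @gt0_ltr_powR R _ e10 1 2; rewrite powR1; apply; rewrite ?nnegrE// ltr1n.
  have := ler_cvg_to lhs rhs (nearW _ step).
  by move=> /(_ _ _); rewrite mulr0 add0r; exact.
exists (K + K); first by rewrite addr_ge0.
have pE t : 0 <= t -> K * t `^ (eta - 1) * t = K * t `^ eta.
  rewrite le_eqVlt => /predU1P[<-|t0].
    by rewrite mulr0 powR0 ?mulr0// gt_eqF//; lra.
  have := powR_D (eta - 1) 1 t0; rewrite subrK (powRr1 (ltW t0)) => ->.
  by rewrite mulrA.
move=> x y xM yM xy1; have Kp : 0 <= K * `|x - y| `^ eta by rewrite mulr_ge0 ?powR_ge0.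
rewrite mulrDl; have [xy|yx] := leP x y.
  have d0 : 0 <= y - x by rewrite subr_ge0.
  rewrite distrC (ger0_norm d0) in xy1 Kp *.
  have := half x y xy xM yM xy1; rewrite pE//; lra.
have d0 : 0 <= x - y by rewrite subr_ge0 ltW.
rewrite (ger0_norm d0) in xy1 Kp *.
have h1 := half y x (ltW yx) yM xM xy1; rewrite pE// in h1.
have h2 := K2 y x yM xM; rewrite distrC (ger0_norm d0) in h2.
have {}h2 : `|(s y - s x) * (x - y)| <= K * (x - y) `^ eta.
  by rewrite normrM (ger0_norm d0) -pE// ler_wpM2r//; apply: h2.
have -> : dyadic_limit y - dyadic_limit x - s x * (y - x) =
  - (dyadic_limit x - dyadic_limit y - s y * (x - y)) - (s y - s x) * (x - y) by ring.
by apply: le_trans (ler_normB _ _) _; rewrite normrN lerD.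
Qed.

End dyadic_holder.

(** * Regularity of the dyadic limit of one path *)

Section regular_paths.
Context {R : realType}.

Lemma locally_holder_le1 (beta : R) (g : R -> R) : 0 < beta -> beta <= 1 ->
  (forall K, compact K -> holder_on beta K g) -> locally_holder beta g.
Proof.
move=> b0 b1 hg; exists 0%N; rewrite b0 b1 subr0; split=> // K cK; exact: hg.
Qed.

Lemma locally_holder_le2 (beta : R) (g s : R -> R) : 1 < beta -> beta <= 2 ->
  (forall x : R, is_derive x 1 g (s x)) ->
  (forall K, compact K -> holder_on (beta - 1) K s) -> locally_holder beta g.
Proof.
move=> b1 b2 dg hs; exists 1%N; rewrite b1 b2; split=> // [j|K cK].
  by rewrite ltnS leqn0 => /eqP-> x; have [] := dg x.
have -> : derive1n 1 g = s by apply/funext => x; rewrite /= derive1E; have [_ <-] := dg x.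
exact: hs.
Qed.

(** The hypotheses keep eta off 1: beta < 1 gives eta < 1, where values are chained, and beta >= 1
    gives eta > 1, where quotients are. *)
Lemma dyadic_limit_regular (f : R -> R) (beta eta : R) :
  0 < beta -> beta < eta -> eta <= 2 -> (beta < 1 -> eta < 1) -> dyadic_diff2_le f eta ->
  [/\ forall x, cvgn (fun n => f (dyadic n (dyadic_cell n (x : R)))),
      continuous (dyadic_limit f)
    & locally_holder beta (dyadic_limit f)].
Proof.
move=> b0 be e2 b1 h; have [blt1|bge1] := ltP beta 1.
  have [||Yc Yh] := @dyadic_holder_lt1 R f eta _ _ h; [lra|exact: b1|].
  split => //; first by apply: holder_locally_continuous Yh; lra.
  apply: (locally_holder_le1 b0 (ltW blt1)) => K cK.
  exact: (holder_on_of_locally b0 (ltW be) Yh cK).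
have h2 : dyadic_diff2_le f 2^-1 by apply: dyadic_diff2_weaken h; lra.
have [||Yc Yh] := @dyadic_holder_lt1 R f 2^-1 _ _ h2; [lra|lra|].
have e1 : 1 < eta by lra.
have [s [sh hs] ] := dyadic_holder_gt1 e1 h.
split => //; first by apply: holder_locally_continuous Yh; lra.
have dY := is_derive_holder e1 hs.
(* beta = 1 falls under k = 0 in [locally_holder]: a Lipschitz bound is due, obtained from the
   boundedness of s on [- M, M] and the Taylor remainder. *)
move: bge1; rewrite le_eqVlt => /predU1P[b_1|bgt1].
  suff Yl : holder_locally 1 (dyadic_limit f).
    rewrite -b_1; apply: (locally_holder_le1 ltr01 (lexx _)) => K cK.
    exact: (holder_on_of_locally ltr01 (lexx _) Yl cK).
  move=> M; have [C C0 HC] := hs M.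
  have e10 : 0 < eta - 1 by lra.
  have [L HL] := holder_on_of_locally e10 (lexx _) sh (@segment_compact R (- M%:R) M%:R).
  have M0 : 0 <= M%:R :> R by [].
  pose B := `|s 0| + `|L| * M%:R `^ (eta - 1).
  have sB x : - M%:R <= x < M%:R -> `|s x| <= B.
    move=> /andP[x1 x2]; have := HL 0 x _ _; rewrite /= !in_itv/= subr0 => H.
    have {}H : `|s x - s 0| <= L * `|x| `^ (eta - 1).
      by apply: H; apply/andP; split; lra.
    have -> : s x = s 0 + (s x - s 0) by ring.
    apply: le_trans (ler_normD _ _) _; rewrite lerD2l; apply: (le_trans H).
    apply: (@le_trans _ _ (`|L| * `|x| `^ (eta - 1))).
      by rewrite ler_wpM2r ?powR_ge0// ler_norm.
    by rewrite ler_wpM2l//; apply: ler_powRl; rewrite ?(ltW e10)// ler_norml; apply/andP; split; lra.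
  have B0 : 0 <= B by rewrite addr_ge0// mulr_ge0// powR_ge0.
  exists (B + C); first by rewrite addr_ge0.
  move=> x y xM yM xy1; rewrite powRr1//.
  have hh := HC x y xM yM xy1.
  have pp : `|x - y| `^ eta <= `|x - y|.
    have [->|n0] := eqVneq (x - y) 0; first by rewrite normr0 powR0// gt_eqF//; lra.
    have -> : eta = (eta - 1) + 1 by ring.
    rewrite powR_D ?normr_gt0// powRr1// ler_piMl//.
    by have := @ler_powRl R (eta - 1) `|x - y| 1; rewrite powR1; apply => //; lra.
  rewrite distrC.
  have -> : dyadic_limit f y - dyadic_limit f x =
    (dyadic_limit f y - dyadic_limit f x - s x * (y - x)) + s x * (y - x) by ring.
  apply: le_trans (ler_normD _ _) _; rewrite mulrDl addrC; apply: lerD.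
    by rewrite normrM [`|y - x|]distrC ler_wpM2r// sB.
  by apply: (le_trans hh); rewrite ler_wpM2l.
apply: (locally_holder_le2 bgt1 (le_trans (ltW be) e2) dY) => K cK.
by apply: (holder_on_of_locally _ _ sh cK); lra.
Qed.

End regular_paths.

(** * Construction of the version *)

Section version.
Context {d : measure_display} {Omega : measurableType d} {R : realType}.
Variable P : probability Omega R.
Variable X : R -> {RV P >-> R}.

Local Notation diff2 n k w :=
  (X (dyadic n (k + 2)) w - X (dyadic n (k + 1)) w *+ 2 + X (dyadic n k) w).

(* The k-th of the 2 M 2^n dyadic cells of generation n in [-M, M[. *)
Let index (M n k : nat) : int := k%:Z - (M * 2 ^ n)%:Z.

(** Constants in the natural numbers leave only countable quantifiers, so the event is
    measurable. *)
Let good (r : R) : set Omega := [set w | forall M, exists j : nat, forall n k,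
  (k < 2 * M * 2 ^ n)%N -> `|diff2 n (index M n k) w| <= j%:R * r ^+ n].

Let measurable_diff2 n k : measurable_fun setT (fun w => diff2 n k w).
Proof.
apply: measurable_funD => //; apply: measurable_funB => //.
by under eq_fun do rewrite -mulr_natr; apply: measurable_funM.
Qed.

Let measurable_good r : measurable (good r).
Proof.
have -> : good r = \bigcap_M \bigcup_j \bigcap_n \bigcap_k
    [set w | (k < 2 * M * 2 ^ n)%N -> `|diff2 n (index M n k) w| <= j%:R * r ^+ n].
  apply/seteqP; split => w /=.
    by move=> h M _; have [j hj] := h M; exists j => // n _ k _; exact: hj.
  by move=> h M; have [j _ hj] := h M I; exists j => n k; exact: hj.
apply: bigcap_measurable => // M _; apply: bigcup_measurable => j _.
apply: bigcap_measurable => // n _; apply: bigcap_measurable => // k _.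
have [kN|kN] := boolP (k < 2 * M * 2 ^ n)%N; last first.
  rewrite (_ : mkset _ = setT)//; by apply/seteqP; split.
rewrite (_ : mkset _ = ~` ([set w | j%:R * r ^+ n <= `|diff2 n (index M n k) w|] `\`
   [set w | `|diff2 n (index M n k) w| <= j%:R * r ^+ n])); last first.
  apply/seteqP; split => w /=; first by move=> /(_ isT) h [].
  by move=> h _; rewrite leNgt; apply/negP => lt; apply: h; rewrite ltW//; split => //; apply/negP; rewrite -ltNge.
apply: measurableC; apply: measurableD; first exact: measurable_norm_ge.
have mn : measurable_fun setT (fun w => `|diff2 n (index M n k) w|) by exact: measurableT_comp.
have mt : measurable ([set true] : set bool) by [].
have := @measurable_fun_ler _ _ _ setT _ _ mn (measurable_cst (j%:R * r ^+ n)) measurableT _ mt.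
by rewrite setTI.
Qed.

Lemma good_diff2_le (eta : R) w : good (2 `^ (- eta)) w -> dyadic_diff2_le (fun t => X t w) eta.
Proof.
move=> g M; have [j hj] := g M; exists j%:R => // n k.
rewrite /dyadic => /andP[]; rewrite ler_pdivlMr ?exprn_gt0// ltr_pdivrMr ?exprn_gt0//.
have -> : - M%:R * 2 ^+ n = (- (M * 2 ^ n)%:Z)%:~R :> R.
  by rewrite mulrNz -pmulrn natrM natrX mulNr.
have -> : M%:R * 2 ^+ n = ((M * 2 ^ n)%:Z)%:~R :> R.
  by rewrite -pmulrn natrM natrX.
rewrite ler_int ltr_int => k1 k2.
have [i [iM ->] ] := int_offset k1 k2.
by apply: hj; rewrite -mulnA.
Qed.

(** The order m must exceed eta by more than 1/alpha, the cost of a union over 2^n cells. For first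
    differences any positive order [m1] is enough, since they are used at one point t at a time. *)
Lemma kolmogorov_second_differences (alpha beta eta m m1 K K1 : R) :
  0 < alpha -> 0 < beta -> beta < eta -> eta <= 2 -> (beta < 1 -> eta < 1) ->
  0 < m1 -> eta + alpha^-1 < m -> 0 <= K -> 0 <= K1 ->
  (forall t h u, 0 < h -> h <= 1 -> 0 < u ->
    (P [set w | (u <= `|X (t + h *+ 2)%R w - X (t + h)%R w *+ 2 + X t w|)%R]
       <= (K * (h `^ m) `^ alpha * u `^ (- alpha))%:E)%E) ->
  (forall t h u, 0 <= h -> h <= 1 -> 0 < u ->
    (P [set w | (u <= `|X (t + h)%R w - X t w|)%R]
       <= (K1 * (h `^ m1) `^ alpha * u `^ (- alpha))%:E)%E) ->
  exists Y : R -> {RV P >-> R},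
    [/\ is_version X Y,
        forall w : Omega, continuous (fun t : R => Y t w)
      & {ae P, forall w : Omega, locally_holder beta (fun t : R => Y t w)}].
Proof.
move=> a0 b0 be e2 b1 m10 em K0 K10 H2 H1.
pose rho : R := 2 `^ (- eta).
have rho0 : 0 < rho by rewrite powR_gt0.
have pow2 (q : R) n : (2 `^ (- q)) ^+ n = (2 ^- n) `^ q.
  rewrite -powR_mulrn ?powR_ge0// -powRrM -(@powR_mulrn R 2)// -powRN -powRrM.
  by congr (_ `^ _); ring.
have pow2lt (q : R) : 0 < q -> 2 `^ (- q) < 1 :> R.
  move=> q0; rewrite powRN invf_lt1 ?powR_gt0//.
  by have := @gt0_ltr_powR R q q0 1 2; rewrite powR1; apply; rewrite ?nnegrE// ltr1n.
have h0 n : 0 < 2 ^- n :> R by rewrite invr_gt0 exprn_gt0.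
have h1 n : 2 ^- n <= 1 :> R by rewrite invf_le1 ?exprn_gt0// exprn_ege1// ler1n.
have add2 (c : int) : c + 2 = c + 1 + 1 by rewrite -addrA.
have good_ae : {ae P, forall w, good rho w}.
  apply: ae_foralln => M.
  (* There are 2 M 2^n cells, each with probability at most K 2^(- n m alpha) 2^(n eta alpha) u^(-
     alpha): the product is geometric of ratio z, and eta + 1/alpha < m means z < 1. *)
  pose z : R := 2 `^ (- ((m - eta) * alpha - 1)).
  have q0 : 0 < (m - eta) * alpha - 1.
    rewrite subr_gt0 -ltr_pdivrMr// mul1r; lra.
  pose V n k w := diff2 n (index M n k) w.
  pose D n := K * ((2 ^- n) `^ m) `^ alpha * (rho ^+ n) `^ (- alpha).
  apply: (@ae_bounded_ratio _ _ _ P V (fun n => (2 * M * 2 ^ n)%N) (fun n => rho ^+ n) D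
    alpha (2 * M%:R * K) z) => //.
  - by rewrite !mulr_ge0.
  - exact: powR_ge0.
  - exact: pow2lt.
  - by move=> n; exact: exprn_gt0.
  - move=> n k; exact: measurable_diff2.
  - move=> n k u _ u0; rewrite /V; set c := index M n k.
    have -> : dyadic n (c + 2) = dyadic n c + 2 ^- n *+ 2 :> R.
      by rewrite add2 !dyadicD1 mulr2n addrA.
    rewrite dyadicD1.
    apply: le_trans (H2 _ _ _ (h0 n) (h1 n) (mulr_gt0 u0 (exprn_gt0 n rho0))) _.
    rewrite powRM ?(ltW u0) ?exprn_ge0 ?(ltW rho0)//.
    have -> : D n * u `^ (- alpha) =
      K * ((2 ^- n) `^ m) `^ alpha * (u `^ (- alpha) * (rho ^+ n) `^ (- alpha)).
      by rewrite /D; ring.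
    exact: lexx.
  move=> n; rewrite /D /z /rho !pow2 -!powRrM !natrM natrX.
  have -> : (2 ^- n) `^ ((m - eta) * alpha - 1) =
     2 ^+ n * ((2 ^- n) `^ (m * alpha) * (2 ^- n) `^ (eta * - alpha)) :> R.
    have E : 2 ^+ n = (2 ^- n) `^ (- 1) :> R.
      by rewrite powRN (powRr1 (ltW (h0 n))) invrK.
    by rewrite [X in _ = X * _]E -!powR_D//; congr (_ `^ _); ring.
  by rewrite le_eqVlt; apply/orP; left; apply/eqP; ring.
(* Outside the good event the path is replaced by 0. Limits then exist and are continuous for every
   w, and Y t is measurable as an everywhere pointwise limit. *)
pose f w (s : R) : R := X s w * \1_(good rho) w.
have f_good w s : good rho w -> f w s = X s w.
  by move=> gw; rewrite /f indicE mem_set// mulr1.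
have f_diff2 w : dyadic_diff2_le (f w) eta.
  have [gw|ngw] := pselect (good rho w).
    have -> : f w = (fun s => X s w) by apply/funext => s; exact: f_good.
    exact: good_diff2_le.
  have f_0 s : f w s = 0 by rewrite /f indicE memNset// mulr0.
  by move=> M; exists 0 => // n k _; rewrite !f_0 mul0rn subrr add0r normr0 mul0r.
have f_reg w := dyadic_limit_regular b0 be e2 b1 (f_diff2 w).
have mY t : measurable_fun setT (fun w => dyadic_limit (f w) t).
  apply: (@measurable_fun_cvg _ _ _ _ (fun n w => f w (dyadic n (dyadic_cell n t)))).
    by move=> n; apply: measurable_funM => //; exact: measurable_indic (measurable_good rho).
  by move=> w _; have [c _ _] := f_reg w; exact: c.
pose Y t : {RV P >-> R} := mfun_Sub (mem_set (mY t)).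
exists Y; split; last 2 first.
- by move=> w; have [_ c _] := f_reg w.
- by apply: aeW => w; have [_ _ l] := f_reg w.
(* Half of the order m1 is spent on the rate s^n, the other half makes the probabilities
   summable. *)
move=> t; pose delta := m1 / 2; have d0 : 0 < delta by rewrite divr_gt0.
pose s : R := 2 `^ (- delta); have s0 : 0 < s by rewrite powR_gt0.
have conv : {ae P, forall w, exists j : nat, forall n k, (k < 1)%N ->
    `|X t w - X (dyadic n (dyadic_cell n t)) w| <= j%:R * s ^+ n}.
  pose z : R := 2 `^ (- (delta * alpha)).
  pose D n := K1 * ((2 ^- n) `^ m1) `^ alpha * (s ^+ n) `^ (- alpha).
  apply: (@ae_bounded_ratio _ _ _ P (fun n _ w => X t w - X (dyadic n (dyadic_cell n t)) w)
    (fun=> 1%N) (fun n => s ^+ n) D alpha K1 z) => //.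
  - exact: powR_ge0.
  - by apply: pow2lt; rewrite mulr_gt0.
  - by move=> n; exact: exprn_gt0.
  - by move=> n _; exact: measurable_funB.
  - move=> n _ u _ u0; have /andP[t1 t2] := dyadic_cell_itv n t.
    set t0 := dyadic n _ in t1 t2 *.
    have e0 : 0 <= t - t0 by rewrite subr_ge0.
    have eh : t - t0 <= 2 ^- n by rewrite lerBlDl ltW.
    have := H1 t0 (t - t0) _ e0 (le_trans eh (h1 n)) (mulr_gt0 u0 (exprn_gt0 n s0)).
    have -> : t0 + (t - t0) = t by ring.
    move/le_trans; apply; rewrite lee_fin.
    rewrite powRM ?(ltW u0) ?exprn_ge0 ?(ltW s0)// /D -[leRHS]mulrA [(s ^+ n) `^ _ * _]mulrC.
    apply: ler_wpM2r; first by apply: mulr_ge0; exact: powR_ge0.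
    apply: (ler_wpM2l K10).
    apply: ler_powRl; rewrite ?powR_ge0 ?(ltW a0)//.
    by apply: ler_powRl; rewrite // ltW.
  move=> n; rewrite mul1r /D /z /s !pow2 -!powRrM -mulrA -powR_D//.
  rewrite le_eqVlt; apply/orP; left; apply/eqP; congr (_ * _ `^ _).
  by rewrite /delta; field.
apply: filterS2 good_ae conv => w gw [j hj].
rewrite /Y/=; apply/cvg_lim => //.
apply/cvgrPdist_le => e ee0.
have sc : (j%:R * s ^+ n) @[n --> \oo] --> (0 : R).
  rewrite -[X in _ --> X](mulr0 (j%:R : R)); apply: cvgM; first exact: cvg_cst.
  by apply: cvg_expr; rewrite ger0_norm ?(ltW s0)// pow2lt.
near=> n; rewrite f_good//; apply: le_trans (hj n 0%N isT) _.
have : `|0 - j%:R * s ^+ n| <= e by near: n; move/cvgrPdist_le : sc; exact.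
by apply: le_trans; rewrite sub0r normrN ler_norm.
Unshelve. all: end_near. Qed.

End version.

Theorem proposition13 (R : realType) (d : measure_display)
    (Omega : measurableType d) (P : probability Omega R)
    (a b alpha gamma lambda : R) (H : R -> R) (X : R -> {RV P >-> R})
    (a_gt0 : 0 < a) (a_le_b : a <= b) (b_le2 : b <= 2)
    (H_cont : continuous H) (H_range : forall t : R, a <= H t <= b)
    (alpha_gt0 : 0 < alpha) (alpha_le2 : alpha <= 2) (lambda_gt0 : 0 < lambda)
    (X_ltmfsm : is_LTmFSM alpha lambda H X)
    (gamma_gt : alpha^-1 < gamma)
    (H_holder : exists C : R, forall t s : R, `|t - s| <= 1 ->
       `|H t - H s| <= C * `|t - s| `^ gamma)
    (exponent_gt1 : 1 < alpha * Num.min a gamma) :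
  forall beta : R, 0 < beta -> beta < Num.min a gamma - alpha^-1 ->
  exists Y : R -> {RV P >-> R},
    [/\ is_version X Y,
        forall w : Omega, continuous (fun t : R => Y t w)
      & {ae P, forall w : Omega, locally_holder beta (fun t : R => Y t w)}].
Proof.
move=> beta beta0 betam.
have [C HC] := H_holder.
have q0 : 0 < alpha^-1 by rewrite invr_gt0.
set m0 := Num.min a gamma in exponent_gt1 betam.
have m0a : m0 <= a by rewrite ge_min lexx.
have m0g : m0 <= gamma by rewrite ge_min lexx orbT.
have a2 : a <= 2 := le_trans a_le_b b_le2.
have p00 : 0 < a - alpha^-1 by lra.
have H_range2 t : a <= H t <= 2.
  by have /andP[-> h] := H_range t; exact: le_trans b_le2.
(* A midpoint between beta and its upper limit; the minimum with 1 keeps eta below 1 when beta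
   is. *)
have [eta [eta1 eta2 eta3] ] : exists eta, [/\ beta < eta, eta < m0 - alpha^-1 & beta < 1 -> eta < 1].
  have [b1|b1] := ltP beta 1.
    exists ((beta + Num.min 1 (m0 - alpha^-1)) / 2).
    have h1 : Num.min 1 (m0 - alpha^-1) <= 1 by rewrite ge_min lexx.
    have h2 : Num.min 1 (m0 - alpha^-1) <= m0 - alpha^-1 by rewrite ge_min lexx orbT.
    have h3 : beta < Num.min 1 (m0 - alpha^-1) by rewrite lt_min b1 betam.
    by split => // *; lra.
  by exists ((beta + (m0 - alpha^-1)) / 2); split => // *; lra.
(* Halfway between eta + 1/alpha, imposed by the union bound, and min(a, gamma), the limit of the
   kernel estimates. *)
pose m := (eta + alpha^-1 + m0) / 2.
have [K K0 HK] : exists2 K, 0 <= K & forall t h u, 0 < h -> h <= 1 -> 0 < u ->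
    (P [set w | (u <= `|X (t + h *+ 2)%R w - X (t + h)%R w *+ 2 + X t w|)%R]
       <= (K * (h `^ m) `^ alpha * u `^ (- alpha))%:E)%E.
  by apply: (ltmfsm_diff2_tail alpha_gt0 lambda_gt0 X_ltmfsm p00 H_range2 HC); rewrite /m; lra.
(* The first-difference estimate holds only for orders up to 1. *)
pose m1 := Num.min 1 m.
have m1m : m1 <= m by rewrite ge_min lexx orbT.
have m11 : m1 <= 1 by rewrite ge_min lexx.
have m10 : 0 < m1 by rewrite lt_min ltr01 /m; lra.
have mm0 : m < m0 by rewrite /m; lra.
have [K1 K10 HK1] : exists2 K, 0 <= K & forall t h u, 0 <= h -> h <= 1 -> 0 < u ->
    (P [set w | (u <= `|X (t + h)%R w - X t w|)%R]
       <= (K * (h `^ m1) `^ alpha * u `^ (- alpha))%:E)%E.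
  by apply: (ltmfsm_diff_tail alpha_gt0 lambda_gt0 X_ltmfsm p00 H_range2 HC); lra.
apply: (kolmogorov_second_differences alpha_gt0 beta0 eta1 _ eta3 m10 _ K0 K10 HK HK1).
  lra.
by rewrite /m; lra.
Qed.
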